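(* Let $q\in\mathbb C$ with $\operatorname{Re} q>0$. Let $r>\frac{2}{\operatorname{Re} q}$ and let $G_r\in\mathcal J_r$. Then: (a) $G_r$ can be extended as a univalent (holomorphic injective) function to the disk $D_{\rho(r)}$, where $$\rho(r)=\left(\sqrt{2r\operatorname{Re} q}-\sqrt{r\operatorname{Re} q-1}\right)^2>1,$$ and (the extension) satisfies $G_r(D_{\rho(r)})\subset D_{\rho_1(r)}$ with $$\rho_1(r)=\sqrt{\frac{2r\operatorname{Re} q}{r\operatorname{Re} q-1}}-1 .$$ (b) $G_r(D_{\rho(r)})\supset D_{\rho_2(r)}$, where $$\rho_2(r)=\frac{\left(\sqrt{2r\operatorname{Re} q}-\sqrt{r\operatorname{Re} q-1}\right)^2}{|1+rq|+\sqrt{2+r\operatorname{Re} q+r^2|q|^2}} .$$ Moreover: (c) For any $r>0$ and any $G_r\in\mathcal J_r$, we have $G_r(\mathbb D)\supset D_{\rho_3(r)}$, where $$\rho_3(r)=\frac{1}{|1+rq|+\sqrt{|1+rq|^2-1}} .$$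
   Context: Notation: $D_s=\{z\in\mathbb C:|z|<s\}$ and $\mathbb D=D_1$ is the open unit disk. Fix $q\in\mathbb C$ with $\operatorname{Re} q>0$. Consider generators $f$ on $\mathbb D$ with $f(0)=0$ and $f'(0)=q$; these are exactly the functions $f(z)=zp(z)$ with $p:\mathbb D\to\mathbb C$ holomorphic, $\operatorname{Re} p(z)\ge 0$ on $\mathbb D$ and $p(0)=q$. It is known that for every such $f$ and every $r>0$ there is a unique holomorphic map $G_r:\mathbb D\to\mathbb D$ satisfying $G_r(w)+r f(G_r(w))=w$ for all $w\in\mathbb D$; it is univalent with $G_r(0)=0$, is written $G_r=(\mathrm{Id}+rf)^{-1}$, and is called the nonlinear resolvent of $f$ with parameter $r$. For $r>0$, $\mathcal J_r$ denotes the set of all resolvents $G_r=(\mathrm{Id}+rf)^{-1}$ of all such $f$ (with the fixed $q$). *)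

(* Defs.v *)
From Stdlib Require Import Reals.
From Coquelicot Require Import Coquelicot.
Open Scope R_scope.

Definition Disk (s : R) (z : C) : Prop := Cmod z < s.

(* For an open set [U]; functions on [U] are total functions [C -> C] whose
   values outside [U] are irrelevant. *)
Definition holomorphic_on (U : C -> Prop) (f : C -> C) : Prop :=
  forall z, U z -> ex_derive (K := C_AbsRing) (V := C_NormedModule) f z.

Definition injective_on (U : C -> Prop) (f : C -> C) : Prop :=
  forall z w, U z -> U w -> f z = f w -> z = w.

Definition univalent_on (U : C -> Prop) (f : C -> C) : Prop :=
  holomorphic_on U f /\ injective_on U f.

Definition maps_into (U V : C -> Prop) (f : C -> C) : Prop :=
  forall z, U z -> V (f z).

Definition image_contains (f : C -> C) (U V : C -> Prop) : Prop :=
  forall w, V w -> exists z, U z /\ f z = w.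

(* [f] is the generator [z p(z)] on the unit disk with [f(0) = 0] and
   [f'(0) = q] (Berkson-Porta form for the fixed point at the origin). *)
Definition generator (q : C) (f : C -> C) : Prop :=
  exists p : C -> C,
    holomorphic_on (Disk 1) p /\
    (forall z, Disk 1 z -> 0 <= Re (p z)) /\
    p 0 = q /\
    (forall z, Disk 1 z -> f z = (z * p z)%C).

(* [G = (Id + r f)^{-1}]: the holomorphic self-map of the unit disk solving
   the resolvent equation; for a generator [f] and [r > 0] it is unique. *)
Definition is_resolvent (f : C -> C) (r : R) (G : C -> C) : Prop :=
  holomorphic_on (Disk 1) G /\
  maps_into (Disk 1) (Disk 1) G /\
  (forall w, Disk 1 w -> (G w + r * f (G w))%C = w).

Definition resolvents (q : C) (r : R) (G : C -> C) : Prop :=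
  exists f, generator q f /\ is_resolvent f r G.

Definition rho (q : C) (r : R) : R :=
  (sqrt (2 * r * Re q) - sqrt (r * Re q - 1)) ^ 2.

Definition rho1 (q : C) (r : R) : R :=
  sqrt (2 * r * Re q / (r * Re q - 1)) - 1.

Definition rho2 (q : C) (r : R) : R :=
  (sqrt (2 * r * Re q) - sqrt (r * Re q - 1)) ^ 2
  / (Cmod (1 + r * q) + sqrt (2 + r * Re q + r ^ 2 * Cmod q ^ 2)).

Definition rho3 (q : C) (r : R) : R :=
  1 / (Cmod (1 + r * q) + sqrt (Cmod (1 + r * q) ^ 2 - 1)).

(* Main.v *)
Require Import Defs.
From Stdlib Require Import Reals Lra Lia Psatz ClassicalEpsilon.
From Coquelicot Require Import Coquelicot.

(** With [P = 1 + r p], the resolvent solves [z P(z) = w], i.e. [z] is a fixed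
    point of [z |-> w / P(z)].  The Schwarz lemma for [(p - q) / (p + conj q)]
    gives [|P(z)| >= 1 + a (1 - |z|) / (1 + |z|)] with [a = r Re q], and
    [s (1 + a (1 - s) / (1 + s))] is maximal at [s = rho1], with value [rho].
    So for [|w| < rho] the fixed-point map sends the disk of radius [rho1] well
    inside itself and contracts the pseudo-hyperbolic distance (Schwarz-Pick);
    its unique fixed point depends on [w] in a locally Lipschitz, hence
    holomorphic, way.  The covering radii come from the upper bound for [|P|]
    on the disk containing [p(z)].

    Complex differentiability is only assumed pointwise, so the Schwarz lemma
    needs a maximum principle without Cauchy's formula: by Goursat a holomorphic
    [w] has a primitive [W], which has second-order expansions everywhere, and
    real parts of functions with such expansions obey the maximum principle by
    comparing the values at [z + t u], [u = 1, i, -1, -i].  This is applied to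
    difference quotients of [W] divided by [z]. *)

(** * Complex differentiability *)

(** What shapes the Schwarz lemma is a gap of one order: comparing values in four directions needs a
    second-order expansion, and [w] has only a first-order one. The quotient [(W (z + k) - W z) / k]
    has second-order expansions and tends to [w] as [k] tends to 0. Subtracting its value at 0 makes
    it divisible by [z], at the price of a mere first-order expansion at 0.

    All inversions come from [inverse_mult_eq], with radii [(1, 1)] or [(rho1, rho)]. The first pair
    gives uniqueness of the solution of [z P(z) = w] in the unit disk, which identifies the
    extension with [G] and settles (c). A point [z] is covered once [|z P(z)|] is below the radius
    of the source disk, so (b) and (c) ask for [|P(z)| < t] with [t = rho / |z|] or [t = 1 / |z|].
    With [B = |1 + r q|] and [a = r Re q], the denominators of [rho2] and [rho3] are [B + S], where
    [S^2 = B^2 - (a - 1)] and [S^2 = B^2 - 1] respectively. *)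

Definition lin_approx (f : C -> C) (z A : C) : Prop :=
  forall eps, 0 < eps -> exists d, 0 < d /\
    forall h, Cmod h < d -> Cmod (f (z + h) - f z - A * h)%C <= eps * Cmod h.

(** The epsilon-delta form involves no choice of normed-module structure on [C]. This lemma and the
    next identify it with differentiability for the two structures in use, so that the calculus
    rules applied to one of them serve [holomorphic_on], which is stated for the other. *)
Lemma is_derive_lin_approx (f : C -> C) (z A : C) :
  is_derive (K := C_AbsRing) (V := AbsRing_NormedModule C_AbsRing) f z A <-> lin_approx f z A.
Proof.
split.
- intros [_ H] eps Heps.
  specialize (H z (fun P HP => HP) (mkposreal eps Heps)).
  destruct H as [d Hd]; exists d; split; [apply cond_pos|].
  intros h Hh.
  specialize (Hd (z + h)%C).
  change (Cmod (z + h - z)%C < d -> Cmod (f (z + h) - f z - (z + h - z) * A)%C <= eps * Cmod (z + h - z)%C) in Hd.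
  replace (z + h - z)%C with h in Hd by ring.
  rewrite (Cmult_comm h A) in Hd; auto.
- intros H; split; [apply is_linear_scal_l|].
  intros x Hx eps.
  apply (is_filter_lim_locally_unique (K := C_AbsRing) (V := AbsRing_NormedModule C_AbsRing)) in Hx; subst x.
  destruct (H eps (cond_pos eps)) as [d [Hd0 Hd]].
  exists (mkposreal d Hd0); intros y Hy.
  change (Cmod (y - z)%C < d) in Hy.
  change (Cmod (f y - f z - (y - z) * A)%C <= eps * Cmod (y - z)%C).
  assert (E : forall a b : C, (a + (b - a))%C = b) by (intros; ring).
  specialize (Hd _ Hy); rewrite E in Hd.
  rewrite (Cmult_comm (y - z)%C A); auto.
Qed.

Lemma is_derive_C_lin_approx (f : C -> C) (z A : C) :
  is_derive (K := C_AbsRing) (V := C_NormedModule) f z A <-> lin_approx f z A.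
Proof.
rewrite <- is_derive_lin_approx.
split; intros [_ H]; (split; [apply is_linear_scal_l|exact H]).
Qed.

Lemma lin_approx_plus f g z A B :
  lin_approx f z A -> lin_approx g z B -> lin_approx (fun x => f x + g x)%C z (A + B)%C.
Proof.
rewrite <- !is_derive_lin_approx; intros.
now apply (is_derive_plus (K := C_AbsRing) (V := AbsRing_NormedModule C_AbsRing)).
Qed.

Lemma lin_approx_mult f g z A B :
  lin_approx f z A -> lin_approx g z B ->
  lin_approx (fun x => f x * g x)%C z (A * g z + f z * B)%C.
Proof.
rewrite <- !is_derive_lin_approx; intros.
apply (is_derive_mult (K := C_AbsRing)); auto.
intros; apply Cmult_comm.
Qed.

Lemma lin_approx_comp f g z A B :
  lin_approx f (g z) A -> lin_approx g z B -> lin_approx (fun x => f (g x)) z (B * A)%C.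
Proof.
rewrite <- !is_derive_lin_approx; intros.
now apply (is_derive_comp (K := C_AbsRing) (V := AbsRing_NormedModule C_AbsRing)).
Qed.

Lemma lin_approx_const c z : lin_approx (fun _ => c) z 0.
Proof. apply is_derive_lin_approx; apply (is_derive_const (K := C_AbsRing) (V := AbsRing_NormedModule C_AbsRing)). Qed.

Lemma lin_approx_id z : lin_approx (fun x => x) z 1.
Proof. apply is_derive_lin_approx; apply (is_derive_id (K := C_AbsRing)). Qed.

Lemma lin_approx_cont f z A : lin_approx f z A ->
  forall eps, 0 < eps -> exists d, 0 < d /\ forall h, Cmod h < d -> Cmod (f (z + h) - f z)%C < eps.
Proof.
intros H eps He; destruct (H 1 Rlt_0_1) as [d [Hd Hh]].
assert (HA : 0 < Cmod A + 1) by (generalize (Cmod_ge_0 A); lra).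
exists (Rmin d (eps / (Cmod A + 1))); split.
{ apply Rmin_pos; auto; apply Rdiv_lt_0_compat; auto. }
intros h Hlt.
assert (H1 : Cmod h < d) by (eapply Rlt_le_trans; [exact Hlt|apply Rmin_l]).
assert (H2 : Cmod h < eps / (Cmod A + 1)) by (eapply Rlt_le_trans; [exact Hlt|apply Rmin_r]).
replace (f (z + h) - f z)%C with ((f (z + h) - f z - A * h) + A * h)%C by ring.
eapply Rle_lt_trans; [apply Cmod_triangle|]; rewrite Cmod_mult.
specialize (Hh h H1).
apply Rlt_div_r in H2; auto; nra.
Qed.

Lemma Cmod_sub_comm a b : Cmod (a - b)%C = Cmod (b - a)%C.
Proof. rewrite <- Cmod_opp; f_equal; ring. Qed.

Lemma Cmod_sub_rev a b : Cmod a - Cmod b <= Cmod (a - b)%C.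
Proof.
generalize (Cmod_triangle (a - b)%C b).
replace (a - b + b)%C with a by ring; lra.
Qed.

Lemma lin_approx_inv (z : C) : z <> 0%C -> lin_approx (fun x => / x)%C z (- / (z * z))%C.
Proof.
intros Hz eps He.
assert (Hm : 0 < Cmod z) by exact (proj1 (Cmod_gt_0 z) Hz).
set (m := Cmod z) in *.
assert (K : 0 < eps * (m * m * m) / 2).
{ repeat apply Rmult_lt_0_compat; auto; lra. }
exists (Rmin (m / 2) (eps * (m * m * m) / 2)); split.
{ apply Rmin_pos; lra. }
intros h Hlt.
assert (H1 : Cmod h < m / 2) by (eapply Rlt_le_trans; [exact Hlt|apply Rmin_l]).
assert (H2 : Cmod h < eps * (m * m * m) / 2) by (eapply Rlt_le_trans; [exact Hlt|apply Rmin_r]).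
assert (H3 : m / 2 < Cmod (z + h)%C).
{ generalize (Cmod_sub_rev z (- h)%C); rewrite Cmod_opp.
  replace (z - - h)%C with (z + h)%C by ring; fold m; lra. }
assert (Hzh : (z + h)%C <> 0%C) by (apply Cmod_gt_0; lra).
(* The remainder is exactly [h^2 / ((z + h) z^2)], and [|h| < |z| / 2] keeps the denominator away
   from 0. *)
replace (/ (z + h) - / z - - / (z * z) * h)%C with (h * h / ((z + h) * (z * z)))%C by (field; auto).
rewrite Cmod_div by (repeat apply Cmult_neq_0; auto).
rewrite !Cmod_mult; fold m.
set (n := Cmod (z + h)%C) in *.
generalize (Cmod_ge_0 h); set (k := Cmod h) in *; intros Hk.
apply Rle_div_l. { repeat apply Rmult_lt_0_compat; lra. }
assert (k <= eps * (n * (m * m))).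
{ apply Rle_trans with (eps * (m * m * m) / 2); [lra|].
  replace (eps * (m * m * m) / 2) with (eps * (m / 2 * (m * m))) by field.
  apply Rmult_le_compat_l; [lra|]. apply Rmult_le_compat_r; [nra|lra]. }
nra.
Qed.

Lemma lin_approx_div (f g : C -> C) (z A B : C) : g z <> 0%C ->
  lin_approx f z A -> lin_approx g z B ->
  exists D, lin_approx (fun x => f x / g x)%C z D.
Proof.
intros Hg Hf HB; eexists.
exact (lin_approx_mult f (fun x => / g x)%C z _ _ Hf
  (lin_approx_comp (fun x => / x)%C g z _ _ (lin_approx_inv _ Hg) HB)).
Qed.

Lemma holomorphic_lin_approx U f z : holomorphic_on U f -> U z -> exists A, lin_approx f z A.
Proof.
intros H Hz; destruct (H z Hz) as [A HA]; exists A; now apply is_derive_C_lin_approx.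
Qed.

(** * The maximum principle *)

Lemma Cmod_le_ReIm (z : C) : Cmod z <= Rabs (Re z) + Rabs (Im z).
Proof.
replace z with (RtoC (Re z) + Ci * RtoC (Im z))%C at 1 by (destruct z; unfold Ci, RtoC, Cplus, Cmult; simpl; f_equal; ring).
eapply Rle_trans; [apply Cmod_triangle|].
rewrite Cmod_mult, !Cmod_R, Cmod_Ci; lra.
Qed.

(** A Lebesgue-number argument: local radii become uniform because [P z d] survives a decrease of
    [d]. Compactness is applied to the square around the disk, so a point outside the disk gets a
    radius so small that no point of the disk is near it. *)
Lemma closed_disk_compact (s : R) (P : C -> R -> Prop) :
  (forall z d d', 0 < d' -> d' <= d -> P z d -> P z d') ->
  (forall z, Cmod z <= s -> exists d, 0 < d /\
     forall z', Cmod z' <= s -> Cmod (z' - z)%C < d -> P z' d) ->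
  exists d, 0 < d /\ forall z, Cmod z <= s -> P z d.
Proof.
intros Hmon Hloc.
(* The factor 2 pays for the passage to the modulus: two coordinates within [d] give a distance
   below [2 * d]. *)
assert (Hall : forall u v : R, exists d : posreal,
  forall z', Cmod z' <= s -> Cmod (z' - (u, v))%C < 2 * d -> P z' d).
{ intros u v; destruct (Rle_lt_dec (Cmod (u, v)) s) as [H|H].
  - destruct (Hloc _ H) as [d [Hd HP]].
    assert (Hd2 : 0 < d / 2) by lra.
    exists (mkposreal _ Hd2); simpl; intros z' Hz' Hlt.
    apply (Hmon _ d); [lra|lra|]; apply HP; auto; lra.
  - assert (Hd2 : 0 < (Cmod (u, v) - s) / 2) by lra.
    exists (mkposreal _ Hd2); simpl; intros z' Hz' Hlt; exfalso.
    generalize (Cmod_sub_rev (u, v) z'); rewrite (Cmod_sub_comm (u, v) z'); lra. }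
pose (delta := fun u v => proj1_sig (constructive_indefinite_description _ (Hall u v))).
destruct (compactness_value_2d (- s) s (- s) s delta) as [d Hd].
exists d; split; [apply cond_pos|]; intros z Hz.
assert (Hre : - s <= Re z <= s).
{ apply Rabs_le_between; eapply Rle_trans; [apply re_le_Cmod|auto]. }
assert (Him : - s <= Im z <= s).
{ apply Rabs_le_between; eapply Rle_trans; [|exact Hz].
  eapply Rle_trans; [apply Rmax_r|apply Rmax_Cmod]. }
specialize (Hd (Re z) (Im z) Hre Him).
apply NNPP; intro HnP; apply Hd; intros [u [v [_ [_ [H1 [H2 H3]]]]]]; apply HnP.
apply (Hmon _ (delta u v)); auto; [apply cond_pos|].
unfold delta in *; destruct (constructive_indefinite_description _ (Hall u v)) as [d' Hd']; simpl in *.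
apply Hd'; auto.
eapply Rle_lt_trans; [apply Cmod_le_ReIm|].
destruct z as [x y]; simpl in *.
change (Rabs (x - u) + Rabs (y - v) < 2 * d'); lra.
Qed.

(** Upper semicontinuity suffices, and compactness enters twice: [v z * d <= 1] yields the upper
    bound [/ d0], and if the supremum [M] were not attained, [v z <= M - d] would yield an upper
    bound below [M]. *)
Lemma closed_disk_max (s : R) (v : C -> R) : 0 <= s ->
  (forall z, Cmod z <= s -> forall e, 0 < e -> exists d, 0 < d /\
     forall h, Cmod h < d -> v (z + h)%C < v z + e) ->
  exists z1, Cmod z1 <= s /\ forall z, Cmod z <= s -> v z <= v z1.
Proof.
intros Hs Husc.
assert (Hc : forall z z' : C, (z + (z' - z))%C = z') by (intros; ring).
destruct (closed_disk_compact s (fun z d => v z * d <= 1)) as [d0 [Hd0 Hb]].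
{ intros z d d' H1 H2 H3.
  destruct (Rle_lt_dec 0 (v z)) as [H|H]; nra. }
{ intros z Hz; destruct (Husc z Hz 1 Rlt_0_1) as [d [Hd H]].
  pose (K := Rabs (v z) + 1).
  assert (HK : 0 < K) by (unfold K; generalize (Rabs_pos (v z)); lra).
  exists (Rmin d (/ K)); split; [apply Rmin_pos; auto; now apply Rinv_0_lt_compat|].
  intros z' Hz' Hlt.
  assert (H1 : Cmod (z' - z)%C < d) by (eapply Rlt_le_trans; [exact Hlt|apply Rmin_l]).
  specialize (H _ H1); rewrite Hc in H.
  assert (H2 : v z' <= K) by (unfold K; generalize (Rle_abs (v z)); lra).
  assert (H3 : Rmin d (/ K) <= / K) by apply Rmin_r.
  assert (H4 : 0 < Rmin d (/ K)) by (apply Rmin_pos; auto; now apply Rinv_0_lt_compat).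
  apply Rle_trans with (K * / K); [|rewrite Rinv_r; lra].
  apply Rle_trans with (K * Rmin d (/ K)); nra. }
destruct (completeness (fun y => exists z, Cmod z <= s /\ y = v z)) as [M [HM1 HM2]].
{ exists (/ d0); intros y [z [Hz ->]]; specialize (Hb z Hz).
  apply (Rmult_le_reg_r d0); auto; rewrite Rinv_l; lra. }
{ exists (v 0%C), 0%C; split; auto; rewrite Cmod_0; auto. }
apply NNPP; intro Hno.
assert (Hbig : forall z, Cmod z <= s -> v z < M).
{ intros z Hz; apply NNPP; intro HzM; apply Hno; exists z; split; auto.
  intros z' Hz'; apply Rle_trans with M; [|lra].
  apply HM1; exists z'; auto. }
destruct (closed_disk_compact s (fun z d => v z <= M - d)) as [d1 [Hd1 Hu]].
{ intros; lra. }
{ intros z Hz; specialize (Hbig z Hz).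
  assert (He : 0 < (M - v z) / 2) by lra.
  destruct (Husc z Hz _ He) as [d [Hd H]].
  exists (Rmin d ((M - v z) / 2)); split; [apply Rmin_pos; auto|].
  intros z' Hz' Hlt.
  assert (H1 : Cmod (z' - z)%C < d) by (eapply Rlt_le_trans; [exact Hlt|apply Rmin_l]).
  specialize (H _ H1); rewrite Hc in H.
  generalize (Rmin_r d ((M - v z) / 2)); lra. }
assert (M <= M - d1); [|lra].
apply HM2; intros y [z [Hz ->]]; auto.
Qed.

(** A second-order Taylor expansion in Peano's form, with [B] in the role of half a second
    derivative. It is a condition at the single point [z]. *)
Definition quad_approx (f : C -> C) (z : C) : Prop :=
  exists A B : C, forall eps, 0 < eps -> exists d, 0 < d /\
    forall h, Cmod h < d ->
      Cmod (f (z + h) - f z - A * h - B * (h * h))%C <= eps * Cmod h ^ 2.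

Lemma quad_approx_lin f z : quad_approx f z -> exists A, lin_approx f z A.
Proof.
intros [A [B H]]; exists A; intros eps He.
destruct (H 1 Rlt_0_1) as [d [Hd Hq]].
assert (HK : 0 < 1 + Cmod B) by (generalize (Cmod_ge_0 B); lra).
exists (Rmin d (eps / (1 + Cmod B))); split.
{ apply Rmin_pos; auto; now apply Rdiv_lt_0_compat. }
intros h Hlt.
assert (H1 : Cmod h < d) by (eapply Rlt_le_trans; [exact Hlt|apply Rmin_l]).
assert (H2 : Cmod h < eps / (1 + Cmod B)) by (eapply Rlt_le_trans; [exact Hlt|apply Rmin_r]).
apply Rlt_div_r in H2; auto.
specialize (Hq h H1).
replace (f (z + h) - f z - A * h)%C
  with ((f (z + h) - f z - A * h - B * (h * h)) + B * (h * h))%C by ring.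
eapply Rle_trans; [apply Cmod_triangle|].
rewrite !Cmod_mult.
generalize (Cmod_ge_0 h); nra.
Qed.

Lemma quad_approx_plus f g z :
  quad_approx f z -> quad_approx g z -> quad_approx (fun x => f x + g x)%C z.
Proof.
intros [A [B H]] [A' [B' H']]; exists (A + A')%C, (B + B')%C; intros eps He.
destruct (H (eps / 2)) as [d [Hd Hq]]; [lra|].
destruct (H' (eps / 2)) as [d' [Hd' Hq']]; [lra|].
exists (Rmin d d'); split; [now apply Rmin_pos|]; intros h Hlt.
assert (H1 : Cmod h < d) by (eapply Rlt_le_trans; [exact Hlt|apply Rmin_l]).
assert (H2 : Cmod h < d') by (eapply Rlt_le_trans; [exact Hlt|apply Rmin_r]).
specialize (Hq _ H1); specialize (Hq' _ H2).
replace (f (z + h) + g (z + h) - (f z + g z) - (A + A') * h - (B + B') * (h * h))%C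
  with ((f (z + h) - f z - A * h - B * (h * h)) + (g (z + h) - g z - A' * h - B' * (h * h)))%C by ring.
eapply Rle_trans; [apply Cmod_triangle|]; lra.
Qed.

Lemma quad_approx_scal c f z : quad_approx f z -> quad_approx (fun x => c * f x)%C z.
Proof.
intros [A [B H]]; exists (c * A)%C, (c * B)%C; intros eps He.
assert (HK : 0 < 1 + Cmod c) by (generalize (Cmod_ge_0 c); lra).
destruct (H (eps / (1 + Cmod c))) as [d [Hd Hq]]; [now apply Rdiv_lt_0_compat|].
exists d; split; auto; intros h Hlt; specialize (Hq h Hlt).
replace (c * f (z + h) - c * f z - c * A * h - c * B * (h * h))%C
  with (c * (f (z + h) - f z - A * h - B * (h * h)))%C by ring.
rewrite Cmod_mult.
apply Rle_trans with ((1 + Cmod c) * (eps / (1 + Cmod c) * Cmod h ^ 2)).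
- generalize (Cmod_ge_0 c) (Cmod_ge_0 (f (z + h) - f z - A * h - B * (h * h))%C); nra.
- right; field; lra.
Qed.

Lemma quad_approx_affine a b z : quad_approx (fun x => a * x + b)%C z.
Proof.
exists a, (RtoC 0); intros eps He; exists 1; split; [lra|]; intros h _.
replace (a * (z + h) + b - (a * z + b) - a * h - 0 * (h * h))%C with (RtoC 0) by ring.
rewrite Cmod_0; generalize (Cmod_ge_0 h); nra.
Qed.

Lemma quad_approx_shift f k z : quad_approx f (z + k)%C -> quad_approx (fun x => f (x + k)%C) z.
Proof.
intros [A [B H]]; exists A, B; intros eps He; destruct (H eps He) as [d [Hd Hq]].
exists d; split; auto; intros h Hlt.
replace (z + h + k)%C with (z + k + h)%C by ring; auto.
Qed.

Lemma quad_approx_local f g z r : 0 < r ->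
  (forall h, Cmod h < r -> f (z + h)%C = g (z + h)%C) -> quad_approx f z -> quad_approx g z.
Proof.
intros Hr E [A [B H]]; exists A, B; intros eps He; destruct (H eps He) as [d [Hd Hh]].
exists (Rmin d r); split; [apply Rmin_pos; auto|].
intros h Hlt.
assert (Cmod h < d) by (eapply Rlt_le_trans; [exact Hlt|apply Rmin_l]).
assert (Cmod h < r) by (eapply Rlt_le_trans; [exact Hlt|apply Rmin_r]).
rewrite <- E by auto.
replace (g z) with (f z); [now apply Hh|].
specialize (E (RtoC 0)); replace (z + 0)%C with z in E by ring.
apply E; rewrite Cmod_0; auto.
Qed.

Lemma quad_approx_div_id (f : C -> C) (z : C) : z <> 0%C ->
  quad_approx f z -> quad_approx (fun x => f x / x)%C z.
Proof.
intros Hz [A [B H]].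
assert (Hm : 0 < Cmod z) by exact (proj1 (Cmod_gt_0 z) Hz).
set (m := Cmod z) in *.
(* Both coefficients are read off from [(z + h) (f z / z + a1 h + a2 h^2) = f z + A h + B h^2 + a2
   h^3]. The new error is therefore the old one minus [a2 h^3], divided by [z + h]. *)
set (a1 := ((A - f z / z) / z)%C).
set (a2 := ((B - a1) / z)%C).
exists a1, a2; intros eps He.
destruct (H (eps * m / 4)) as [d [Hd Hq]]; [nra|].
assert (HK : 0 < 1 + Cmod a2) by (generalize (Cmod_ge_0 a2); lra).
set (d2 := eps * m / 4 / (1 + Cmod a2)).
assert (Hd2 : 0 < d2) by (unfold d2; apply Rdiv_lt_0_compat; nra).
exists (Rmin d (Rmin (m / 2) d2)); split.
{ repeat apply Rmin_pos; auto; lra. }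
intros h Hlt.
generalize (Rmin_l d (Rmin (m / 2) d2)) (Rmin_r d (Rmin (m / 2) d2)) (Rmin_l (m / 2) d2) (Rmin_r (m / 2) d2); intros M1 M2 M3 M4.
assert (H1 : Cmod h < d) by lra.
assert (H2 : Cmod h < m / 2) by lra.
assert (H3 : Cmod h < d2) by lra.
unfold d2 in H3; apply Rlt_div_r in H3; auto.
specialize (Hq h H1).
assert (H4 : m / 2 < Cmod (z + h)%C).
{ generalize (Cmod_sub_rev z (- h)%C); rewrite Cmod_opp.
  replace (z - - h)%C with (z + h)%C by ring; fold m; lra. }
assert (Hzh : (z + h)%C <> 0%C) by (apply Cmod_gt_0; lra).
set (e := (f (z + h) - f z - A * h - B * (h * h))%C) in *.
replace (f (z + h) / (z + h) - f z / z - a1 * h - a2 * (h * h))%C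
  with ((e - a2 * (h * h * h)) / (z + h))%C.
2: { unfold e, a2, a1; field; auto. }
rewrite Cmod_div by auto.
apply Rle_div_l; [lra|].
eapply Rle_trans; [apply Cmod_triangle|].
rewrite Cmod_opp, !Cmod_mult.
generalize (Cmod_ge_0 h) (Cmod_ge_0 a2); intros K1 K2.
assert (K3 : Cmod a2 * (Cmod h * Cmod h * Cmod h) <= eps * m / 4 * Cmod h ^ 2).
{ replace (Cmod a2 * (Cmod h * Cmod h * Cmod h)) with (Cmod h * Cmod a2 * Cmod h ^ 2) by ring.
  apply Rmult_le_compat_r; [nra|]; lra. }
assert (K4 : eps * Cmod h ^ 2 * (m / 2) <= eps * Cmod h ^ 2 * Cmod (z + h)%C).
{ apply Rmult_le_compat_l; [|lra]. apply Rmult_le_pos; [lra|apply pow2_ge_0]. }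
lra.
Qed.

Lemma Re_Cmod_bounds (z : C) : - Cmod z <= Re z <= Cmod z.
Proof. apply Rabs_le_between, re_le_Cmod. Qed.

(** Over the four directions both [u] and [u^2] sum to 0, so the terms in [A] and [B] and the cross
    term of [|z + t u|^2] cancel. The added square contributes [4 e t^2] to the sum, the errors at
    most half of that. *)
Lemma quad_approx_not_max (f : C -> C) (z : C) (e r : R) : 0 < e -> 0 < r -> quad_approx f z ->
  exists h, Cmod h < r /\
    Re (f z) + e * Cmod z ^ 2 < Re (f (z + h)%C) + e * Cmod (z + h)%C ^ 2.
Proof.
intros He Hr [A [B H]].
destruct (H (e / 2)) as [d0 [Hd0 Hq]]; [lra|].
set (d := Rmin d0 r).
assert (Hd : 0 < d) by now apply Rmin_pos.
generalize (Rmin_l d0 r) (Rmin_r d0 r); fold d; intros Ml Mr.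
apply NNPP; intros Hno.
assert (Hmax : forall h, Cmod h < d ->
    Re (f (z + h)%C) + e * Cmod (z + h)%C ^ 2 <= Re (f z) + e * Cmod z ^ 2).
{ intros h Hh; apply Rnot_lt_le; intros Hlt; apply Hno; exists h; split; auto; lra. }
set (t := d / 2).
assert (Ht : 0 < t < d) by (unfold t; lra).
assert (Hu : forall u : C, Cmod u = 1 ->
  t * Re (A * u)%C + t ^ 2 * Re (B * (u * u))%C - e / 2 * t ^ 2
  + e * (2 * t * (Re z * Re u + Im z * Im u) + t ^ 2) <= 0).
{ intros u Hu.
  assert (Hm : Cmod (t * u)%C = t).
  { rewrite Cmod_mult, Cmod_R, Hu, Rabs_pos_eq; lra. }
  specialize (Hq (t * u)%C); specialize (Hmax (t * u)%C).
  rewrite Hm in Hq, Hmax; specialize (Hq ltac:(lra)); specialize (Hmax (proj2 Ht)).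
  generalize (Re_Cmod_bounds (f (z + t * u) - f z - A * (t * u) - B * (t * u * (t * u)))%C).
  rewrite !Cmod2_alt in Hmax.
  assert (Hu2 : Re u ^ 2 + Im u ^ 2 = 1) by (rewrite <- Cmod2_alt, Hu; ring).
  intros Hre.
  assert (R1 : forall w w' : C, Re (w - w' - A * (t * u) - B * (t * u * (t * u)))%C
     = Re w - Re w' - t * Re (A * u)%C - t ^ 2 * Re (B * (u * u))%C) by (intros; unfold Re, Im; simpl; ring).
  rewrite R1 in Hre.
  replace (Re (z + t * u)%C) with (Re z + t * Re u) in Hmax by (unfold Re, Im; simpl; ring).
  replace (Im (z + t * u)%C) with (Im z + t * Im u) in Hmax by (unfold Re, Im; simpl; ring).
  assert (t ^ 2 = t ^ 2 * (Re u ^ 2 + Im u ^ 2)) by (rewrite Hu2; ring).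
  nra. }
generalize (Hu (RtoC 1) Cmod_1) (Hu (- (1))%C Cmod_m1) (Hu Ci Cmod_Ci).
assert (Hmi : Cmod (- Ci)%C = 1) by (rewrite Cmod_opp; apply Cmod_Ci).
generalize (Hu (- Ci)%C Hmi).
assert (Het : 0 < e * t ^ 2) by (apply Rmult_lt_0_compat; auto; apply pow_lt; lra).
destruct A as [a1 a2], B as [b1 b2], z as [x y]; unfold Re, Im, Ci, RtoC in *; simpl in *; lra.
Qed.

(** For [h = t * Cconj A] the linear term is the positive number [t |A|^2], and the error is at most
    half of it. *)
Lemma lin_approx_not_max (f : C -> C) (z A : C) : A <> 0%C -> lin_approx f z A ->
  forall d, 0 < d -> exists h, Cmod h < d /\ Re (f z) < Re (f (z + h)%C).
Proof.
intros HA H d Hd.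
assert (Hm : 0 < Cmod A) by exact (proj1 (Cmod_gt_0 A) HA).
destruct (H (Cmod A / 2)) as [d' [Hd' Hh]]; [lra|].
set (t := Rmin d d' / 2 / Cmod A).
assert (Hmin : 0 < Rmin d d') by now apply Rmin_pos.
assert (Ht : 0 < t) by (unfold t; apply Rdiv_lt_0_compat; lra).
assert (Htm : t * Cmod A = Rmin d d' / 2) by (unfold t; field; lra).
assert (Hth : Cmod (t * Cconj A)%C = Rmin d d' / 2).
{ rewrite Cmod_mult, Cmod_R, Cmod_conj, Rabs_pos_eq; lra. }
generalize (Rmin_l d d') (Rmin_r d d'); intros M1 M2.
exists (t * Cconj A)%C; split; [lra|].
specialize (Hh (t * Cconj A)%C); rewrite Hth in Hh; specialize (Hh ltac:(lra)).
generalize (Re_Cmod_bounds (f (z + t * Cconj A) - f z - A * (t * Cconj A))%C); intros Hre.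
assert (R1 : forall w w' : C, Re (w - w' - A * (t * Cconj A))%C
  = Re w - Re w' - t * (Re A ^ 2 + Im A ^ 2)) by (intros; unfold Re, Im; simpl; ring).
rewrite R1 in Hre.
rewrite <- Cmod2_alt in Hre.
rewrite <- Htm in Hh. nra.
Qed.

(* The perturbation [eta z] moves the critical point away from the exceptional
   point 0, and [e |z|^2] makes the real part strictly subharmonic elsewhere. *)
Lemma max_principle (f : C -> C) (s M : R) : 0 < s ->
  (forall z : C, Cmod z <= s -> z <> 0%C -> quad_approx f z) ->
  (exists A, lin_approx f 0%C A) ->
  (forall z, Cmod z = s -> Re (f z) <= M) ->
  forall z, Cmod z <= s -> Re (f z) <= M.
Proof.
intros Hs Hq [A HA] Hb z0 Hz0; apply Rnot_lt_le; intros Hlt.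
set (g := Re (f z0) - M).
assert (Hg : 0 < g) by (unfold g; lra).
(* Two candidates are enough, since [A + eta = 0] excludes only one value. *)
assert (Heta : exists eta : R, 0 < eta <= g / (8 * s) /\ (A + eta)%C <> 0%C).
{ assert (0 < g / (8 * s)) by (apply Rdiv_lt_0_compat; lra).
  destruct (Ceq_dec (A + (g / (8 * s))%R)%C 0%C) as [E|E].
  - exists (g / (8 * s) / 2); split; [lra|]; intros E'.
    apply (f_equal Re) in E; apply (f_equal Re) in E'; destruct A; simpl in *; lra.
  - exists (g / (8 * s)); split; [lra|auto]. }
destruct Heta as [eta [[Heta1 Heta2] HA0]].
set (e := g / (8 * s ^ 2)).
assert (He : 0 < e) by (unfold e; apply Rdiv_lt_0_compat; nra).
assert (Hetas : eta * s <= g / 8).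
{ apply Rle_trans with (g / (8 * s) * s); [nra|right; field; lra]. }
assert (Hes : e * s ^ 2 = g / 8) by (unfold e; field; lra).
set (F := fun x => (f x + (RtoC eta * x + 0))%C).
assert (HFq : forall z : C, Cmod z <= s -> z <> 0%C -> quad_approx F z).
{ intros z Hz Hz'; apply quad_approx_plus; [auto|apply quad_approx_affine]. }
assert (HF0 : lin_approx F 0%C (A + eta)%C).
{ apply lin_approx_plus; auto.
  intros eps Heps; exists 1; split; [lra|]; intros h _.
  replace (eta * (0 + h) + 0 - (eta * 0 + 0) - eta * h)%C with (RtoC 0) by ring.
  rewrite Cmod_0; generalize (Cmod_ge_0 h); nra. }
set (v := fun z => Re (F z) + e * Cmod z ^ 2).
destruct (closed_disk_max s v) as [z1 [Hz1 Hmax]]; [lra| |].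
{ intros z Hz eps Heps.
  assert (HL : exists D, lin_approx F z D).
  { destruct (Ceq_dec z 0%C) as [->|E]; [eauto|apply quad_approx_lin; auto]. }
  destruct HL as [D HD].
  destruct (lin_approx_cont F z D HD (eps / 2)) as [d [Hd Hc]]; [lra|].
  assert (HK : 0 < 2 * e * (2 * s + 1)) by nra.
  exists (Rmin d (Rmin 1 (eps / (2 * e * (2 * s + 1))))); split.
  { repeat apply Rmin_pos; auto; [lra|now apply Rdiv_lt_0_compat]. }
  intros h Hh.
  generalize (Rmin_l d (Rmin 1 (eps / (2 * e * (2 * s + 1)))))
   (Rmin_r d (Rmin 1 (eps / (2 * e * (2 * s + 1)))))
   (Rmin_l 1 (eps / (2 * e * (2 * s + 1))))
   (Rmin_r 1 (eps / (2 * e * (2 * s + 1)))); intros M1 M2 M3 M4.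
  specialize (Hc h ltac:(lra)).
  assert (H2 : Cmod h < eps / (2 * e * (2 * s + 1))) by lra.
  apply Rlt_div_r in H2; auto.
  generalize (Re_Cmod_bounds (F (z + h) - F z)%C); intros Hre.
  assert (R1 : forall w w' : C, Re (w - w')%C = Re w - Re w') by (intros; unfold Re, Im; simpl; ring).
  rewrite R1 in Hre.
  unfold v; generalize (Cmod_triangle z h) (Cmod_ge_0 z) (Cmod_ge_0 h) (Cmod_ge_0 (z + h)%C).
  intros T1 T2 T3 T4.
  assert (Cmod (z + h)%C ^ 2 <= Cmod z ^ 2 + Cmod h * (2 * s + 1)) by nra.
  assert (e * Cmod (z + h)%C ^ 2 <= e * (Cmod z ^ 2 + Cmod h * (2 * s + 1))) by (apply Rmult_le_compat_l; lra).
  nra. }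
assert (HReF : forall z, Re (F z) = Re (f z) + eta * Re z).
{ intros z; unfold F; unfold Re, Im; simpl; ring. }
(* The two perturbations alter the comparison between a boundary point and [z0] by at most
   [3 g / 8], less than the gap [g]. *)
assert (Hz1s : Cmod z1 < s).
{ destruct Hz1 as [Hz1|Hz1]; auto; exfalso.
  specialize (Hmax z0 Hz0); unfold v in Hmax; rewrite !HReF, Hz1, Hes in Hmax.
  specialize (Hb z1 Hz1).
  generalize (Re_Cmod_bounds z1) (Re_Cmod_bounds z0); intros [_ B1] [B2 _].
  assert (0 <= e * Cmod z0 ^ 2) by (apply Rmult_le_pos; [lra|apply pow2_ge_0]).
  unfold g in *; nra. }
destruct (Ceq_dec z1 0%C) as [E|E].
- subst z1.
  destruct (lin_approx_not_max F 0%C _ HA0 HF0 s Hs) as [h [Hh Hlt']].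
  specialize (Hmax (0 + h)%C); unfold v in Hmax.
  replace (0 + h)%C with h in * by ring.
  specialize (Hmax ltac:(lra)); rewrite Cmod_0 in Hmax.
  assert (0 <= e * Cmod h ^ 2) by (apply Rmult_le_pos; [lra|apply pow2_ge_0]).
  nra.
- destruct (quad_approx_not_max F z1 e (s - Cmod z1) He ltac:(lra) (HFq z1 Hz1 E)) as [h [Hh Hlt']].
  specialize (Hmax (z1 + h)%C); unfold v in Hmax.
  generalize (Cmod_triangle z1 h); intros T.
  specialize (Hmax ltac:(lra)); lra.
Qed.

(** * Goursat and primitives *)

Lemma scal_C_R (k : R) (z : C) : scal (V := C_R_NormedModule) k z = (k * z)%C.
Proof. destruct z; unfold scal, Cmult, RtoC; simpl; unfold prod_scal, scal; simpl; unfold mult; simpl; f_equal; ring. Qed.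

Lemma norm_C_R (z : C) : norm (V := C_R_NormedModule) z = Cmod z.
Proof. symmetry; apply (Cmod_norm z). Qed.

Definition segint (f : C -> C) (a b : C) : C :=
  ((b - a) * RInt (V := C_R_CompleteNormedModule) (fun t : R => f (a + t * (b - a))%C) 0 1)%C.

Lemma Disk_segment (s : R) (a b : C) (t : R) : 0 <= t <= 1 -> Disk s a -> Disk s b -> Disk s (a + t * (b - a))%C.
Proof.
unfold Disk; intros Ht Ha Hb.
replace (a + t * (b - a))%C with (RtoC (1 - t) * a + t * b)%C by (rewrite RtoC_minus; ring).
eapply Rle_lt_trans; [apply Cmod_triangle|].
rewrite !Cmod_mult, !Cmod_R, !Rabs_pos_eq by lra.
apply Rle_lt_trans with (Rmax (Cmod a) (Cmod b)); [|now apply Rmax_lub_lt].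
generalize (Rmax_l (Cmod a) (Cmod b)) (Rmax_r (Cmod a) (Cmod b)); nra.
Qed.

Lemma ex_RInt_segment s f a b : holomorphic_on (Disk s) f -> Disk s a -> Disk s b ->
  ex_RInt (V := C_R_NormedModule) (fun t : R => f (a + t * (b - a))%C) 0 1.
Proof.
intros Hf Ha Hb.
apply (ex_RInt_continuous (V := C_R_CompleteNormedModule)).
rewrite Rmin_left, Rmax_right by lra; intros t Ht.
destruct (holomorphic_lin_approx _ _ _ Hf (Disk_segment s a b t Ht Ha Hb)) as [A HA].
apply (filterlim_locally (U := C_UniformSpace)); intros eps.
destruct (lin_approx_cont _ _ _ HA eps (cond_pos eps)) as [d [Hd Hc]].
assert (HK : 0 < 1 + Cmod (b - a)%C) by (generalize (Cmod_ge_0 (b - a)%C); lra).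
assert (Hd' : 0 < d / (1 + Cmod (b - a)%C)) by now apply Rdiv_lt_0_compat.
exists (mkposreal _ Hd'); intros t' Ht'.
change (Rabs (t' - t) < d / (1 + Cmod (b - a)%C)) in Ht'.
apply Rlt_div_r in Ht'; auto.
apply (C_NormedModule_mixin_compat1 (f (a + t * (b - a))%C)).
change (Cmod (f (a + t' * (b - a)) - f (a + t * (b - a)))%C < eps).
specialize (Hc (RtoC (t' - t) * (b - a))%C).
replace (a + t * (b - a) + RtoC (t' - t) * (b - a))%C with (a + t' * (b - a))%C in Hc
  by (rewrite RtoC_minus; ring).
apply Hc; rewrite Cmod_mult, Cmod_R.
generalize (Rabs_pos (t' - t)) (Cmod_ge_0 (b - a)%C); nra.
Qed.

Lemma segint_unique f a b I :
  is_RInt (V := C_R_NormedModule) (fun t : R => f (a + t * (b - a))%C) 0 1 I ->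
  segint f a b = ((b - a) * I)%C.
Proof.
intros H; unfold segint; f_equal.
now apply (is_RInt_unique (V := C_R_CompleteNormedModule)).
Qed.

Lemma is_RInt_segment s f a b : holomorphic_on (Disk s) f -> Disk s a -> Disk s b ->
  exists I, is_RInt (V := C_R_NormedModule) (fun t : R => f (a + t * (b - a))%C) 0 1 I.
Proof.
intros Hf Ha Hb; destruct (ex_RInt_segment s f a b Hf Ha Hb) as [I HI]; eauto.
Qed.

Lemma is_RInt_affine_C (al be : C) :
  is_RInt (V := C_R_NormedModule) (fun t : R => (al + be * t)%C) 0 1 (al + be / 2)%C.
Proof.
assert (K : forall x y : R, is_RInt (fun t => x + y * t) 0 1 (x + y / 2)).
{ intros x y.
  set (F := fun t => x * t + y * t ^ 2 / 2).
  replace (x + y / 2) with (minus (F 1) (F 0))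
    by (unfold minus, plus, opp, F; simpl; field).
  apply (is_RInt_derive (V := R_CompleteNormedModule) F (fun t => x + y * t)); intros t _.
  - unfold F; auto_derive; auto; field.
  - apply (ex_derive_continuous (V := R_NormedModule)); auto_derive; auto. }
destruct al as [x1 y1], be as [x2 y2].
replace ((x1, y1) + (x2, y2) / 2)%C with (x1 + x2 / 2, y1 + y2 / 2).
2: { unfold Cplus, Cdiv, Cmult, Cinv; simpl; f_equal; field. }
apply (is_RInt_fct_extend_pair (U := R_NormedModule) (V := R_NormedModule)).
- apply (is_RInt_ext (fun t => x1 + x2 * t)); [intros; simpl; ring|apply K].
- apply (is_RInt_ext (fun t => y1 + y2 * t)); [intros; simpl; ring|apply K].
Qed.

(** The subtracted terms are the exact integral of the affine function [al + be (x - a)]; the rest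
    is at most supremum times length. The slope [be] is what Goursat and the second-order expansion
    of the primitive rely on. *)
Lemma segint_approx s f a b al be M : holomorphic_on (Disk s) f -> Disk s a -> Disk s b ->
  (forall t : R, 0 <= t <= 1 -> Cmod (f (a + t * (b - a)) - al - be * (t * (b - a)))%C <= M) ->
  Cmod (segint f a b - al * (b - a) - be / 2 * ((b - a) * (b - a)))%C <= M * Cmod (b - a)%C.
Proof.
intros Hf Ha Hb HM.
destruct (is_RInt_segment s f a b Hf Ha Hb) as [I HI].
rewrite (segint_unique f a b I HI).
generalize (is_RInt_minus _ _ _ _ _ _ HI (is_RInt_affine_C al (be * (b - a))%C)); intros HD.
replace ((b - a) * I - al * (b - a) - be / 2 * ((b - a) * (b - a)))%C
  with ((b - a) * (I - (al + be * (b - a) / 2)))%C by field.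
rewrite Cmod_mult, Rmult_comm; apply Rmult_le_compat_r; [apply Cmod_ge_0|].
change (Cmod (minus (G := C_R_NormedModule) I (al + be * (b - a) / 2)%C) <= M).
rewrite <- norm_C_R.
replace M with ((1 - 0) * M) by ring.
refine (norm_RInt_le_const _ 0 1 _ M Rle_0_1 _ HD).
intros t Ht; rewrite norm_C_R.
change (Cmod (f (a + t * (b - a)) - (al + be * (b - a) * t))%C <= M).
replace (f (a + t * (b - a)) - (al + be * (b - a) * t))%C
  with (f (a + t * (b - a)) - al - be * (t * (b - a)))%C by ring.
auto.
Qed.

Lemma RtoC_m1 : RtoC (-1) = (- (1))%C.
Proof. unfold RtoC, Copp; simpl; f_equal; ring. Qed.

Lemma segint_rev s f a b : holomorphic_on (Disk s) f -> Disk s a -> Disk s b ->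
  segint f b a = (- segint f a b)%C.
Proof.
intros Hf Ha Hb.
destruct (is_RInt_segment s f a b Hf Ha Hb) as [I HI].
rewrite (segint_unique f a b I HI).
assert (HJ : is_RInt (V := C_R_NormedModule) (fun t : R => f (b + t * (a - b))%C) 0 1 I).
{ assert (H1 := is_RInt_swap _ _ _ _ HI).
  assert (H2 : is_RInt (V := C_R_NormedModule) (fun t : R => f (a + t * (b - a))%C) (-1 * 0 + 1) (-1 * 1 + 1) (opp I)).
  { replace (-1 * 0 + 1) with 1 by ring; replace (-1 * 1 + 1) with 0 by ring; exact H1. }
  apply is_RInt_comp_lin in H2.
  apply (is_RInt_scal _ _ _ (-1)) in H2.
  replace I with (scal (V := C_R_NormedModule) (-1) (opp I)).
  2: { rewrite scal_C_R; change (opp I) with (- I)%C; destruct I; unfold Cmult, Copp, RtoC; simpl; f_equal; ring. }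
  eapply is_RInt_ext; [|exact H2].
  intros t _; cbv beta; rewrite !scal_C_R.
  match goal with |- @eq _ ?x ?y => change (@eq C x y) end.
  replace (a + RtoC (-1 * t + 1) * (b - a))%C with (b + t * (a - b))%C
   by (rewrite RtoC_plus, RtoC_mult, RtoC_m1; ring).
  rewrite RtoC_m1; ring. }
rewrite (segint_unique f b a I HJ); ring.
Qed.

Lemma segint_mid s f a b : holomorphic_on (Disk s) f -> Disk s a -> Disk s b ->
  segint f a b = (segint f a ((a + b) / 2) + segint f ((a + b) / 2) b)%C.
Proof.
intros Hf Ha Hb.
assert (Hm : Disk s ((a + b) / 2)%C).
{ replace ((a + b) / 2)%C with (a + RtoC (/ 2) * (b - a))%C.
  - apply Disk_segment; auto; lra.
  - rewrite RtoC_inv by lra; field. }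
set (m := ((a + b) / 2)%C) in *.
destruct (is_RInt_segment s f a m Hf Ha Hm) as [I HI].
destruct (is_RInt_segment s f m b Hf Hm Hb) as [J HJ].
rewrite (segint_unique f a m I HI), (segint_unique f m b J HJ).
assert (H1 : is_RInt (V := C_R_NormedModule) (fun t : R => f (a + t * (b - a))%C) 0 (1/2) (scal (1/2) I)).
{ assert (HI' : is_RInt (V := C_R_NormedModule) (fun t : R => f (a + t * (m - a))%C) (2 * 0 + 0) (2 * (1/2) + 0) I).
  { replace (2 * 0 + 0) with 0 by ring; replace (2 * (1/2) + 0) with 1 by field; exact HI. }
  apply is_RInt_comp_lin in HI'.
  apply (is_RInt_scal _ _ _ (1/2)) in HI'.
  eapply is_RInt_ext; [|exact HI'].
  intros t _; cbv beta; rewrite !scal_C_R.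
  match goal with |- @eq _ ?x ?y => change (@eq C x y) end.
  replace (a + RtoC (2 * t + 0) * (m - a))%C with (a + t * (b - a))%C.
  - rewrite RtoC_div by lra; field.
  - unfold m; rewrite RtoC_plus, RtoC_mult; field. }
assert (H2 : is_RInt (V := C_R_NormedModule) (fun t : R => f (a + t * (b - a))%C) (1/2) 1 (scal (1/2) J)).
{ assert (HJ' : is_RInt (V := C_R_NormedModule) (fun t : R => f (m + t * (b - m))%C) (2 * (1/2) + -1) (2 * 1 + -1) J).
  { replace (2 * (1/2) + -1) with 0 by field; replace (2 * 1 + -1) with 1 by ring; exact HJ. }
  apply is_RInt_comp_lin in HJ'.
  apply (is_RInt_scal _ _ _ (1/2)) in HJ'.
  eapply is_RInt_ext; [|exact HJ'].
  intros t _; cbv beta; rewrite !scal_C_R.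
  match goal with |- @eq _ ?x ?y => change (@eq C x y) end.
  replace (m + RtoC (2 * t + -1) * (b - m))%C with (a + t * (b - a))%C.
  - rewrite RtoC_div by lra; field.
  - unfold m; rewrite RtoC_plus, RtoC_mult, RtoC_m1; field. }
rewrite (segint_unique f a b _ (is_RInt_Chasles _ _ _ _ _ _ H1 H2)).
rewrite !scal_C_R; change plus with Cplus.
rewrite RtoC_div by lra; unfold m; field.
Qed.

(** The bound on [l - x n] matters as much as the limit: for the nested triangles it places the
    limit close to the [n]-th one, and at [n = 0] it becomes the Lipschitz estimate for fixed
    points. *)
Lemma geometric_limit (x : nat -> C) (K c : R) : 0 <= c < 1 -> 0 <= K ->
  (forall n, Cmod (x (S n) - x n)%C <= K * c ^ n) ->
  exists l : C, (forall n, Cmod (l - x n)%C <= K * c ^ n / (1 - c)) /\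
    forall eps, 0 < eps -> exists N, forall n, (N <= n)%nat -> Cmod (l - x n)%C < eps.
Proof.
intros Hc HK Hx.
assert (Hcn : forall n, 0 <= c ^ n) by (intros; apply pow_le; lra).
assert (Hp : forall n p, Cmod (x (n + p)%nat - x n)%C <= K * c ^ n * ((1 - c ^ p) / (1 - c))).
{ intros n p; induction p as [|p IH].
  - rewrite Nat.add_0_r; replace (x n - x n)%C with (RtoC 0) by ring.
    rewrite Cmod_0; simpl; right; field; lra.
  - rewrite Nat.add_succ_r.
    replace (x (S (n + p)) - x n)%C with ((x (S (n + p)) - x (n + p)%nat) + (x (n + p)%nat - x n))%C by ring.
    eapply Rle_trans; [apply Cmod_triangle|].
    specialize (Hx (n + p)%nat); rewrite pow_add in Hx.
    eapply Rle_trans; [apply Rplus_le_compat; [exact Hx|exact IH]|].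
    right; simpl; field; lra. }
assert (Htail : forall n m, (n <= m)%nat -> Cmod (x m - x n)%C <= K * c ^ n / (1 - c)).
{ intros n m Hn; replace m with (n + (m - n))%nat by lia.
  eapply Rle_trans; [apply Hp|].
  unfold Rdiv; rewrite Rmult_assoc.
  rewrite Rmult_assoc; apply Rmult_le_compat_l; [lra|].
  apply Rmult_le_compat_l; [auto|].
  rewrite <- (Rmult_1_l (/ (1 - c))) at 2.
  apply Rmult_le_compat_r; [|specialize (Hcn (m - n)%nat); lra].
  left; apply Rinv_0_lt_compat; lra. }
assert (Hlim : forall eps, 0 < eps -> exists N, forall n, (N <= n)%nat -> K * c ^ n / (1 - c) < eps).
{ intros eps He.
  assert (Hd : 0 < eps * (1 - c) / (K + 1)) by (apply Rdiv_lt_0_compat; nra).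
  destruct (pow_lt_1_zero c ltac:(rewrite Rabs_pos_eq; lra) _ Hd) as [N HN].
  exists N; intros n Hn; specialize (HN n Hn).
  rewrite Rabs_pos_eq in HN by auto.
  apply Rlt_div_l; [lra|].
  apply Rlt_div_r in HN; [|lra].
  specialize (Hcn n); nra. }
assert (Hcauchy : forall g : C -> R, (forall z w, Rabs (g z - g w) <= Cmod (z - w)%C) ->
  Cauchy_crit (fun n => g (x n))).
{ intros g Hg eps He; destruct (Hlim (eps / 2)) as [N HN]; [lra|]; exists N.
  intros n m Hn Hm; unfold Rdist.
  replace (g (x n) - g (x m)) with ((g (x n) - g (x N)) + - (g (x m) - g (x N))) by ring.
  eapply Rle_lt_trans; [apply Rabs_triang|]; rewrite Rabs_Ropp.
  generalize (Hg (x n) (x N)) (Hg (x m) (x N)) (Htail N n Hn) (Htail N m Hm) (HN N (le_n N)); lra. }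
destruct (Rcomplete.R_complete (fun n => Re (x n))) as [l1 H1].
{ apply Hcauchy; intros z w; apply (re_le_Cmod (z - w)%C). }
destruct (Rcomplete.R_complete (fun n => Im (x n))) as [l2 H2].
{ apply Hcauchy; intros z w; eapply Rle_trans; [apply Rmax_r|apply (Rmax_Cmod (z - w)%C)]. }
assert (Hconv : forall eps, 0 < eps -> exists N, forall n, (N <= n)%nat -> Cmod ((l1, l2) - x n)%C < eps).
{ intros eps He; destruct (H1 (eps / 2)) as [N1 HN1]; [lra|].
  destruct (H2 (eps / 2)) as [N2 HN2]; [lra|].
  exists (max N1 N2); intros n Hn.
  specialize (HN1 n ltac:(lia)); specialize (HN2 n ltac:(lia)); unfold Rdist in *.
  rewrite Cmod_sub_comm.
  eapply Rle_lt_trans; [apply Cmod_le_ReIm|].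
  change (Rabs (Re (x n) - l1) + Rabs (Im (x n) - l2) < eps); lra. }
exists (l1, l2); split; auto.
intros n; apply le_epsilon; intros eps He.
destruct (Hconv eps He) as [N HN].
specialize (HN (max N n) ltac:(lia)); specialize (Htail n (max N n) ltac:(lia)).
replace ((l1, l2) - x n)%C with (((l1, l2) - x (max N n)) + (x (max N n) - x n))%C by ring.
eapply Rle_trans; [apply Cmod_triangle|]; lra.
Qed.

(** * Goursat's theorem by repeated bisection of a triangle *)

Definition triangle : Type := (C * C * C)%type.

Definition triangle_int (f : C -> C) (T : triangle) : C :=
  let '(a, b, c) := T in (segint f a b + segint f b c + segint f c a)%C.

Definition perimeter (T : triangle) : R :=
  let '(a, b, c) := T in Cmod (b - a)%C + Cmod (c - b)%C + Cmod (a - c)%C.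

Definition vertex (T : triangle) : C := let '(a, _, _) := T in a.

(** The three corner triangles and the medial one are oriented so that the inner edges cancel, hence
    one of them carries at least a quarter of the integral. The closed disk of radius [s' < s] keeps
    the limit of the bisection inside the open disk. *)
Lemma triangle_bisect s s' f T : s' < s -> holomorphic_on (Disk s) f ->
  (let '(a, b, c) := T in Cmod a <= s' /\ Cmod b <= s' /\ Cmod c <= s') ->
  exists T', (let '(a, b, c) := T' in Cmod a <= s' /\ Cmod b <= s' /\ Cmod c <= s') /\
    perimeter T' = perimeter T / 2 /\
    Cmod (vertex T' - vertex T)%C <= perimeter T /\
    Cmod (triangle_int f T) / 4 <= Cmod (triangle_int f T').
Proof.
destruct T as [[a b] c]; intros Hs Hf [Ha [Hb Hc]].
assert (Hmid : forall x y : C, Cmod x <= s' -> Cmod y <= s' -> Cmod ((x + y) / 2)%C <= s').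
{ intros x y Hx Hy; replace ((x + y) / 2)%C with (RtoC (/ 2) * (x + y))%C.
  2: { rewrite RtoC_inv by lra; field. }
  rewrite Cmod_mult, Cmod_R, Rabs_pos_eq by lra.
  generalize (Cmod_triangle x y); lra. }
assert (Hhalf : forall x : C, Cmod (x / 2)%C = Cmod x / 2).
{ intros x; replace (x / 2)%C with (RtoC (/ 2) * x)%C.
  2: { rewrite RtoC_inv by lra; field. }
  rewrite Cmod_mult, Cmod_R, Rabs_pos_eq by lra; field. }
set (m1 := ((a + b) / 2)%C); set (m2 := ((b + c) / 2)%C); set (m3 := ((c + a) / 2)%C).
assert (Hm1 : Cmod m1 <= s') by (apply Hmid; auto).
assert (Hm2 : Cmod m2 <= s') by (apply Hmid; auto).
assert (Hm3 : Cmod m3 <= s') by (apply Hmid; auto).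
assert (HD : forall x, Cmod x <= s' -> Disk s x) by (unfold Disk; intros; lra).
assert (Hsum : triangle_int f (a, b, c) =
  (triangle_int f (a, m1, m3) + (triangle_int f (m1, b, m2)
   + (triangle_int f (m3, m2, c) + triangle_int f (m1, m2, m3))))%C).
{ unfold triangle_int.
  rewrite (segint_mid s f a b), (segint_mid s f b c), (segint_mid s f c a); auto.
  fold m1 m2 m3.
  rewrite (segint_rev s f m1 m3), (segint_rev s f m1 m2), (segint_rev s f m2 m3); auto.
  ring. }
generalize (Cmod_ge_0 (b - a)%C) (Cmod_ge_0 (c - b)%C) (Cmod_ge_0 (a - c)%C); intros P1 P2 P3.
assert (E1 : Cmod (m1 - a)%C = Cmod (b - a)%C / 2) by (rewrite <- Hhalf; f_equal; unfold m1; field).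
assert (E2 : Cmod (b - m1)%C = Cmod (b - a)%C / 2) by (rewrite <- Hhalf; f_equal; unfold m1; field).
assert (E3 : Cmod (m2 - b)%C = Cmod (c - b)%C / 2) by (rewrite <- Hhalf; f_equal; unfold m2; field).
assert (E4 : Cmod (c - m2)%C = Cmod (c - b)%C / 2) by (rewrite <- Hhalf; f_equal; unfold m2; field).
assert (E5 : Cmod (m3 - c)%C = Cmod (a - c)%C / 2) by (rewrite <- Hhalf; f_equal; unfold m3; field).
assert (E6 : Cmod (a - m3)%C = Cmod (a - c)%C / 2) by (rewrite <- Hhalf; f_equal; unfold m3; field).
assert (E7 : Cmod (m3 - m1)%C = Cmod (c - b)%C / 2) by (rewrite <- Hhalf; f_equal; unfold m3, m1; field).
assert (E8 : Cmod (m1 - m2)%C = Cmod (a - c)%C / 2) by (rewrite <- Hhalf; f_equal; unfold m1, m2; field).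
assert (E9 : Cmod (m2 - m3)%C = Cmod (b - a)%C / 2) by (rewrite <- Hhalf; f_equal; unfold m2, m3; field).
assert (E10 : Cmod (m3 - a)%C = Cmod (a - c)%C / 2) by (rewrite Cmod_sub_comm; auto).
assert (E0 : Cmod (a - a)%C = 0) by (replace (a - a)%C with (RtoC 0) by ring; apply Cmod_0).
assert (Hcases : forall T1 T2 T3 T4 : triangle,
  Cmod (triangle_int f T1 + (triangle_int f T2 + (triangle_int f T3 + triangle_int f T4)))%C / 4
   <= Cmod (triangle_int f T1) \/
  Cmod (triangle_int f T1 + (triangle_int f T2 + (triangle_int f T3 + triangle_int f T4)))%C / 4
   <= Cmod (triangle_int f T2) \/
  Cmod (triangle_int f T1 + (triangle_int f T2 + (triangle_int f T3 + triangle_int f T4)))%C / 4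
   <= Cmod (triangle_int f T3) \/
  Cmod (triangle_int f T1 + (triangle_int f T2 + (triangle_int f T3 + triangle_int f T4)))%C / 4
   <= Cmod (triangle_int f T4)).
{ intros T1 T2 T3 T4.
  generalize (Cmod_triangle (triangle_int f T1) (triangle_int f T2 + (triangle_int f T3 + triangle_int f T4))%C)
    (Cmod_triangle (triangle_int f T2) (triangle_int f T3 + triangle_int f T4)%C)
    (Cmod_triangle (triangle_int f T3) (triangle_int f T4)); intros.
  set (S := Cmod (triangle_int f T1 + (triangle_int f T2 + (triangle_int f T3 + triangle_int f T4)))%C) in *.
  destruct (Rle_lt_dec (S / 4) (Cmod (triangle_int f T1))); auto.
  destruct (Rle_lt_dec (S / 4) (Cmod (triangle_int f T2))); auto.
  destruct (Rle_lt_dec (S / 4) (Cmod (triangle_int f T3))); auto.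
  do 3 right; lra. }
assert (E11 : Cmod (m1 - m3)%C = Cmod (c - b)%C / 2) by (rewrite Cmod_sub_comm; auto).
assert (E12 : Cmod (m2 - m1)%C = Cmod (a - c)%C / 2) by (rewrite Cmod_sub_comm; auto).
assert (E13 : Cmod (m3 - m2)%C = Cmod (b - a)%C / 2) by (rewrite Cmod_sub_comm; auto).
rewrite Hsum.
destruct (Hcases (a, m1, m3) (m1, b, m2) (m3, m2, c) (m1, m2, m3)) as [H|[H|[H|H]]];
 [exists (a, m1, m3)|exists (m1, b, m2)|exists (m3, m2, c)|exists (m1, m2, m3)];
 (split; [auto|split; [|split; [|exact H]]]);
 unfold perimeter, vertex; rewrite ?E0, ?E1, ?E2, ?E3, ?E4, ?E5, ?E6, ?E7, ?E8, ?E9, ?E10, ?E11, ?E12, ?E13; lra.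
Qed.

Lemma goursat s f a b c : holomorphic_on (Disk s) f -> Disk s a -> Disk s b -> Disk s c ->
  triangle_int f (a, b, c) = 0%C.
Proof.
intros Hf Ha Hb Hc.
set (s' := Rmax (Cmod a) (Rmax (Cmod b) (Cmod c))).
assert (Hs : s' < s) by (repeat apply Rmax_lub_lt; auto).
set (inside := fun T : triangle => let '(a, b, c) := T in Cmod a <= s' /\ Cmod b <= s' /\ Cmod c <= s').
assert (Hin0 : inside (a, b, c)).
{ repeat split; unfold s'; [apply Rmax_l|eapply Rle_trans; [apply Rmax_l|apply Rmax_r]
   |eapply Rle_trans; [apply Rmax_r|apply Rmax_r]]. }
(* The premise [inside T] stands under the existential so that [next] is a total function. *)
assert (Hstep : forall T, exists T', inside T -> inside T' /\
    perimeter T' = perimeter T / 2 /\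
    Cmod (vertex T' - vertex T)%C <= perimeter T /\
    Cmod (triangle_int f T) / 4 <= Cmod (triangle_int f T')).
{ intros T; destruct (classic (inside T)) as [H|H].
  - destruct (triangle_bisect s s' f T Hs Hf H) as [T' HT']; exists T'; auto.
  - exists T; tauto. }
set (next := fun T => proj1_sig (constructive_indefinite_description _ (Hstep T))).
assert (Hnext : forall T, inside T -> inside (next T) /\
    perimeter (next T) = perimeter T / 2 /\
    Cmod (vertex (next T) - vertex T)%C <= perimeter T /\
    Cmod (triangle_int f T) / 4 <= Cmod (triangle_int f (next T))).
{ intros T; exact (proj2_sig (constructive_indefinite_description _ (Hstep T))). }
set (t := fun n => Nat.iter n next (a, b, c)).
set (L := perimeter (a, b, c)).
assert (HL : 0 <= L).
{ unfold L, perimeter; generalize (Cmod_ge_0 (b - a)%C) (Cmod_ge_0 (c - b)%C) (Cmod_ge_0 (a - c)%C); lra. }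
assert (Ht : forall n, inside (t n) /\ perimeter (t n) = L * (1 / 2) ^ n /\
   Cmod (triangle_int f (a, b, c)) * (1 / 4) ^ n <= Cmod (triangle_int f (t n))).
{ induction n as [|n [I1 [I2 I3]]].
  - change (t O) with (a, b, c); fold L; rewrite !pow_O, !Rmult_1_r; split; [exact Hin0|split; [reflexivity|apply Rle_refl]].
  - destruct (Hnext _ I1) as [J1 [J2 [_ J3]]].
    change (t (S n)) with (next (t n)); split; [auto|split].
    + rewrite J2, I2; simpl; field.
    + eapply Rle_trans; [|exact J3]; rewrite <- tech_pow_Rmult; lra. }
destruct (geometric_limit (fun n => vertex (t n)) L (1 / 2)) as [l [Hl Hconv]]; [lra|auto| |].
{ intros n; destruct (Ht n) as [I1 [I2 _]]; rewrite <- I2.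
  change (t (S n)) with (next (t n)); apply Hnext; auto. }
assert (Hls : Disk s l).
{ destruct (Hconv (s - s')) as [N HN]; [lra|]; specialize (HN N (le_n N)).
  destruct (Ht N) as [I1 _]; destruct (t N) as [[x y] w]; simpl in *; destruct I1 as [Hx _].
  generalize (Cmod_sub_rev l x); unfold Disk; lra. }
apply Cmod_eq_0, Rle_antisym; [|apply Cmod_ge_0].
destruct (holomorphic_lin_approx _ _ _ Hf Hls) as [A HA].
apply le_epsilon; intros eps He; rewrite Rplus_0_l.
(* [3 * L ^ 2] is the distance bound [3 L h] times the perimeter [L h], without the factor [h^2];
   the [+ 1] covers [L = 0]. *)
assert (He' : 0 < eps / (3 * L ^ 2 + 1)) by (apply Rdiv_lt_0_compat; nra).
destruct (HA _ He') as [d [Hd Hlin]].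
set (e := eps / (3 * L ^ 2 + 1)) in *.
destruct (pow_lt_1_zero (1 / 2) ltac:(rewrite Rabs_pos_eq; lra) (d / (3 * L + 1))) as [N HN].
{ apply Rdiv_lt_0_compat; lra. }
specialize (HN N (le_n N)); rewrite Rabs_pos_eq in HN by (apply pow_le; lra).
apply Rlt_div_r in HN; [|lra].
specialize (Hl N); destruct (Ht N) as [I1 [I2 I3]].
assert (Hh : 0 < (1 / 2) ^ N) by (apply pow_lt; lra).
assert (Hq : (1 / 4) ^ N = (1 / 2) ^ N * (1 / 2) ^ N) by (rewrite <- Rpow_mult_distr; f_equal; field).
rewrite Hq in I3.
set (h := (1 / 2) ^ N) in *.
destruct (t N) as [[x y] w]; unfold inside, perimeter, vertex in *.
generalize (Cmod_ge_0 (y - x)%C) (Cmod_ge_0 (w - y)%C) (Cmod_ge_0 (x - w)%C); intros P1 P2 P3.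
assert (Hedge : forall u v : C, Cmod u <= s' -> Cmod v <= s' ->
  Cmod (u - x)%C + Cmod (v - u)%C <= L * h ->
  Cmod (segint f u v - (f l + A * (u - l)) * (v - u) - A / 2 * ((v - u) * (v - u)))%C
    <= e * (3 * L * h) * Cmod (v - u)%C).
{ intros u v Hu Hv Huv; apply (segint_approx s); auto; [unfold Disk; lra|unfold Disk; lra|].
  intros r Hr.
  (* The limit [l] is within [2 L h] of the first vertex, and the boundary leads at most [L h]
     further. *)
  assert (Hr' : Cmod (u + r * (v - u) - l)%C <= 3 * L * h).
  { replace (u + r * (v - u) - l)%C with ((x - l) + ((u - x) + r * (v - u)))%C by ring.
    eapply Rle_trans; [apply Cmod_triangle|].
    generalize (Cmod_triangle (u - x)%C (r * (v - u))%C).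
    rewrite Cmod_mult, Cmod_R, (Rabs_pos_eq r) by lra.
    rewrite (Cmod_sub_comm x l).
    assert (r * Cmod (v - u)%C <= 1 * Cmod (v - u)%C) by (apply Rmult_le_compat_r; [apply Cmod_ge_0|lra]).
    replace (L * h / (1 - 1 / 2)) with (2 * L * h) in Hl by field.
    lra. }
  specialize (Hlin (u + r * (v - u) - l)%C).
  replace (l + (u + r * (v - u) - l))%C with (u + r * (v - u))%C in Hlin by ring.
  replace (f (u + r * (v - u)) - (f l + A * (u - l)) - A * (r * (v - u)))%C
    with (f (u + r * (v - u)) - f l - A * (u + r * (v - u) - l))%C by ring.
  eapply Rle_trans; [apply Hlin; lra|].
  apply Rmult_le_compat_l; lra. }
destruct I1 as [Hx [Hy Hw]].
assert (E0 : Cmod (x - x)%C = 0) by (replace (x - x)%C with (RtoC 0) by ring; apply Cmod_0).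
generalize (Hedge x y Hx Hy ltac:(rewrite E0; lra)).
generalize (Hedge y w Hy Hw ltac:(lra)).
assert (Twx := Cmod_triangle (w - y)%C (y - x)%C).
replace (w - y + (y - x))%C with (w - x)%C in Twx by ring.
generalize (Hedge w x Hw Hx ltac:(lra)).
(* The affine part of [f] at [l] integrates to 0 around the closed triangle, so the integral is the
   sum of the three errors. *)
assert (Hsum : triangle_int f (x, y, w) =
 ((segint f x y - (f l + A * (x - l)) * (y - x) - A / 2 * ((y - x) * (y - x))) +
 ((segint f y w - (f l + A * (y - l)) * (w - y) - A / 2 * ((w - y) * (w - y))) +
  (segint f w x - (f l + A * (w - l)) * (x - w) - A / 2 * ((x - w) * (x - w)))))%C).
{ unfold triangle_int; field. }
rewrite Hsum in I3; intros B1 B2 B3.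
set (z1 := (segint f x y - _ - _)%C) in *; set (z2 := (segint f y w - _ - _)%C) in *; set (z3 := (segint f w x - _ - _)%C) in *.
generalize (Cmod_triangle z1 (z2 + z3)%C) (Cmod_triangle z2 z3); intros T1 T2.
set (X := Cmod (triangle_int f (a, b, c))) in *.
assert (HX : X * (h * h) <= e * (3 * L ^ 2) * (h * h)).
{ eapply Rle_trans; [exact I3|].
  replace (e * (3 * L ^ 2) * (h * h)) with (e * (3 * L * h) * (L * h)) by ring.
  rewrite <- I2; lra. }
assert (HX' : X <= e * (3 * L ^ 2)) by (apply (Rmult_le_reg_r (h * h)); [nra|auto]).
assert (He2 : e * (3 * L ^ 2 + 1) = eps) by (unfold e; field; nra).
nra.
Qed.

(** The primitive is given through an estimate that serves two purposes: [be = 0] turns bounds on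
    [f] into bounds on [W b - W a], and [be] equal to the derivative of [f] at [a] gives a
    second-order expansion of [W]. *)
Theorem holomorphic_primitive s f : 0 < s -> holomorphic_on (Disk s) f ->
  exists W : C -> C, forall (a b al be : C) M, Disk s a -> Disk s b ->
    (forall t : R, 0 <= t <= 1 -> Cmod (f (a + t * (b - a)) - al - be * (t * (b - a)))%C <= M) ->
    Cmod (W b - W a - al * (b - a) - be / 2 * ((b - a) * (b - a)))%C <= M * Cmod (b - a)%C.
Proof.
intros Hs Hf; exists (segint f 0%C); intros a b al be M Ha Hb HM.
assert (H0 : Disk s 0%C) by (unfold Disk; rewrite Cmod_0; auto).
assert (HG := goursat s f 0%C a b Hf H0 Ha Hb); unfold triangle_int in HG.
rewrite (segint_rev s f 0%C b) in HG; auto.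
replace (segint f 0 b - segint f 0 a)%C with (segint f a b)%C.
- apply (segint_approx s); auto.
- replace (segint f a b) with ((segint f 0 a + segint f a b + - segint f 0 b) + (segint f 0 b - segint f 0 a))%C by ring.
  rewrite HG; ring.
Qed.

(** * The Schwarz and Schwarz-Pick lemmas *)

(** A removable singularity, filled with the value [A] and having derivative [B]. Dividing by [h]
    costs one order, which is why [max_principle] asks only for [lin_approx] at 0. *)
Lemma quad_approx_div_id_0 (f : C -> C) : f 0%C = 0%C -> quad_approx f 0%C ->
  exists F, (forall z : C, z <> 0%C -> F z = (f z / z)%C) /\ exists D, lin_approx F 0%C D.
Proof.
intros H0 [A [B H]].
exists (fun z => if Ceq_dec z 0%C then A else (f z / z)%C); split.
{ intros z Hz; destruct (Ceq_dec z 0%C); tauto. }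
exists B; intros eps He; destruct (H eps He) as [d [Hd Hq]].
exists d; split; auto; intros h Hh.
destruct (Ceq_dec 0%C 0%C) as [_|E]; [|tauto].
specialize (Hq h Hh); rewrite H0 in Hq.
replace (0 + h)%C with h in * by ring.
destruct (Ceq_dec h 0%C) as [->|E].
- replace (A - A - B * 0)%C with (RtoC 0) by ring; rewrite Cmod_0; lra.
- assert (Hm : 0 < Cmod h) by exact (proj1 (Cmod_gt_0 h) E).
  replace (f h / h - A - B * h)%C with ((f h - 0 - A * h - B * (h * h)) / h)%C by (field; auto).
  rewrite Cmod_div by auto; apply Rle_div_l; auto; nra.
Qed.

Lemma holomorphic_quad_primitive s f : 0 < s -> holomorphic_on (Disk s) f ->
  exists W : C -> C, (forall z, Disk s z -> quad_approx W z) /\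
   forall (a b al : C) M, Disk s a -> Disk s b ->
    (forall t : R, 0 <= t <= 1 -> Cmod (f (a + t * (b - a)) - al)%C <= M) ->
    Cmod (W b - W a - al * (b - a))%C <= M * Cmod (b - a)%C.
Proof.
intros Hs Hf; destruct (holomorphic_primitive s f Hs Hf) as [W HW]; exists W; split.
- intros z Hz; destruct (holomorphic_lin_approx _ _ _ Hf Hz) as [D HD].
  exists (f z), (D / 2)%C; intros eps He.
  destruct (HD eps He) as [d [Hd Hlin]].
  unfold Disk in *.
  exists (Rmin d (s - Cmod z)); split; [apply Rmin_pos; lra|]; intros h Hh.
  generalize (Rmin_l d (s - Cmod z)) (Rmin_r d (s - Cmod z)) (Cmod_triangle z h); intros M1 M2 T.
  specialize (HW z (z + h)%C (f z) D (eps * Cmod h)).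
  replace (z + h - z)%C with h in HW by ring.
  replace (eps * Cmod h ^ 2) with (eps * Cmod h * Cmod h) by ring.
  apply HW; [lra|lra|].
  intros t Ht.
  assert (Hth : Cmod (t * h)%C <= Cmod h).
  { rewrite Cmod_mult, Cmod_R, Rabs_pos_eq by lra; generalize (Cmod_ge_0 h); nra. }
  eapply Rle_trans; [apply Hlin; lra|].
  apply Rmult_le_compat_l; lra.
- intros a b al M Ha Hb HM.
  replace (W b - W a - al * (b - a))%C with (W b - W a - al * (b - a) - 0 / 2 * ((b - a) * (b - a)))%C by field.
  apply HW; auto; intros t Ht.
  replace (f (a + t * (b - a)) - al - 0 * (t * (b - a)))%C with (f (a + t * (b - a)) - al)%C by ring; auto.
Qed.

(** Put [v = w z0 / z0]. The factor [Cconj v] in [Q] makes the real part of [F z0] close to [|v|^2],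
    while [|F| <= |v| (1 + e) / s] on the circle of radius [s]. Letting [e] tend to 0 and then [s]
    to 1 gives [|v| <= 1]. *)
Lemma schwarz (w : C -> C) : holomorphic_on (Disk 1) w ->
  (forall z, Disk 1 z -> Cmod (w z) <= 1) -> w 0%C = 0%C ->
  forall z, Disk 1 z -> Cmod (w z) <= Cmod z.
Proof.
intros Hw Hb H0 z0 Hz0.
destruct (Ceq_dec z0 0%C) as [->|E]; [rewrite H0; lra|].
assert (Hm : 0 < Cmod z0) by exact (proj1 (Cmod_gt_0 z0) E).
destruct (Ceq_dec (w z0) 0%C) as [->|Ew]; [rewrite Cmod_0; lra|].
set (v := (w z0 / z0)%C).
assert (Hv0 : v <> 0%C).
{ unfold v; intros Ev; apply Ew; replace (w z0) with (w z0 / z0 * z0)%C by (field; auto); rewrite Ev; ring. }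
assert (Hv : 0 < Cmod v) by exact (proj1 (Cmod_gt_0 v) Hv0).
assert (Hvm : Cmod v * Cmod z0 = Cmod (w z0)).
{ rewrite <- Cmod_mult; f_equal; unfold v; field; auto. }
destruct (holomorphic_quad_primitive 1 w Rlt_0_1 Hw) as [W [HW1 HW2]].
assert (Hcont : forall z, Disk 1 z -> forall e, 0 < e -> exists d, 0 < d /\ forall k : R, 0 < k < d ->
  Cmod (W (z + k) - W z - w z * k)%C <= e * k).
{ intros z Hz e He; destruct (holomorphic_lin_approx _ _ _ Hw Hz) as [D HD].
  destruct (lin_approx_cont _ _ _ HD e He) as [d [Hd Hc]].
  unfold Disk in *.
  exists (Rmin d (1 - Cmod z)); split; [apply Rmin_pos; lra|]; intros k Hk.
  generalize (Rmin_l d (1 - Cmod z)) (Rmin_r d (1 - Cmod z)) (Cmod_triangle z k); intros M1 M2 T.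
  rewrite Cmod_R, Rabs_pos_eq in T by lra.
  specialize (HW2 z (z + k)%C (w z) e).
  replace (z + k - z)%C with (RtoC k) in HW2 by ring.
  rewrite Cmod_R, Rabs_pos_eq in HW2 by lra.
  apply HW2; unfold Disk; [lra|lra|].
  intros t Ht; left; apply Hc.
  rewrite Cmod_mult, !Cmod_R, !Rabs_pos_eq by lra; nra. }
unfold Disk in *.
assert (Hmain : forall s e, Cmod z0 <= s < 1 -> 0 < e -> Cmod v * (s * Cmod z0) <= (1 + e) * Cmod z0 + 2 * e * s).
{ intros s e Hs He.
  destruct (Hcont z0 Hz0 e He) as [d1 [Hd1 Hc1]].
  destruct (Hcont 0%C) with (e := e) as [d2 [Hd2 Hc2]]; [rewrite Cmod_0; lra|auto|].
  (* [k < 1 - s] keeps [z + k] in the unit disk for [|z| <= s]; [d1] and [d2] make the difference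
     quotients at [z0] and at 0 accurate to within [e]. *)
  set (k := Rmin (1 - s) (Rmin d1 d2) / 2).
  assert (Hk0 : 0 < Rmin (1 - s) (Rmin d1 d2)) by (repeat apply Rmin_pos; lra).
  generalize (Rmin_l (1 - s) (Rmin d1 d2)) (Rmin_r (1 - s) (Rmin d1 d2)) (Rmin_l d1 d2) (Rmin_r d1 d2); intros M1 M2 M3 M4.
  assert (Hk : 0 < k /\ k < 1 - s /\ k < d1 /\ k < d2) by (unfold k; lra).
  clearbody k; destruct Hk as [Hk [K1 [K2 K3]]].
  specialize (Hc1 k ltac:(lra)); specialize (Hc2 k ltac:(lra)).
  rewrite H0 in Hc2; replace (0 + k)%C with (RtoC k) in Hc2 by ring.
  replace (W k - W 0 - 0 * k)%C with (W k - W 0)%C in Hc2 by ring.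
  assert (Hkc : RtoC k <> 0%C) by (apply Cmod_gt_0; rewrite Cmod_R, Rabs_pos_eq; lra).
  (* Written as a sum matching the closure rules of [quad_approx]; [HQ] restores the readable form,
     which vanishes at 0. *)
  set (Q := fun z => (Cconj v / k * (W (z + k) + (-(1) * W z + (0 * z + (W 0 - W k)))))%C).
  assert (HQ : forall z, Q z = (Cconj v / k * ((W (z + k) - W z) - (W k - W 0)))%C).
  { intros z; unfold Q; ring. }
  assert (HQq : forall z, Cmod z <= s -> quad_approx Q z).
  { intros z Hz; apply quad_approx_scal, quad_approx_plus.
    - apply quad_approx_shift, HW1.
      eapply Rle_lt_trans; [apply Cmod_triangle|]; rewrite Cmod_R, Rabs_pos_eq; lra.
    - apply quad_approx_plus; [|apply quad_approx_affine].
      apply quad_approx_scal, HW1; lra. }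
  destruct (quad_approx_div_id_0 Q) as [F [HF1 HF2]].
  { rewrite HQ; replace (0 + k)%C with (RtoC k) by ring; ring. }
  { apply HQq; rewrite Cmod_0; lra. }
  assert (HFm : forall z : C, z <> 0%C -> Cmod (F z) = Cmod v / k * Cmod ((W (z + k) - W z) - (W k - W 0))%C / Cmod z).
  { intros z Hz; rewrite HF1, HQ, Cmod_div, Cmod_mult, Cmod_div by auto.
    rewrite Cmod_conj, Cmod_R, Rabs_pos_eq by lra; reflexivity. }
  assert (Hmax : Re (F z0) <= Cmod v * (1 + e) / s).
  { apply (max_principle F s _); auto; try lra.
    - intros z Hz Hz'.
      apply (quad_approx_local (fun x => Q x / x)%C F z (Cmod z)).
      + exact (proj1 (Cmod_gt_0 z) Hz').
      + intros h Hh; symmetry; apply HF1; intros Eh.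
        assert (Cmod z = Cmod h); [|lra].
        rewrite <- (Cmod_opp h); f_equal.
        replace z with ((z + h) + - h)%C by ring; rewrite Eh; ring.
      + apply quad_approx_div_id; auto.
    - intros z Hz; eapply Rle_trans; [apply Re_Cmod_bounds|].
      rewrite HFm, Hz by (apply Cmod_gt_0; lra).
      (* The first difference is at most [k] because [|w| <= 1], the second at most [e k] because
         [w 0 = 0]. *)
      assert (Cmod ((W (z + k) - W z) - (W k - W 0))%C <= k + e * k).
      { eapply Rle_trans; [apply Cmod_triangle|]; rewrite Cmod_opp.
        apply Rplus_le_compat; auto.
        assert (HzK : Cmod (z + k)%C < 1).
        { eapply Rle_lt_trans; [apply Cmod_triangle|]; rewrite Cmod_R, Rabs_pos_eq; lra. }
        specialize (HW2 z (z + k)%C 0%C 1 ltac:(lra) HzK).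
        replace (z + k - z)%C with (RtoC k) in HW2 by ring.
        rewrite Cmod_R, Rabs_pos_eq in HW2 by lra.
        replace (W (z + k) - W z)%C with (W (z + k) - W z - 0 * k)%C by ring.
        rewrite <- (Rmult_1_l k) at 3; apply HW2; intros t Ht.
        replace (w (z + t * k) - 0)%C with (w (z + t * k)%C) by ring.
        apply Hb.
        eapply Rle_lt_trans; [apply Cmod_triangle|]; rewrite Cmod_mult, !Cmod_R, !Rabs_pos_eq by lra; nra. }
      unfold Rdiv; apply Rmult_le_compat_r; [left; apply Rinv_0_lt_compat; lra|].
      replace (Cmod v * (1 + e)) with (Cmod v * / k * (k + e * k)) by (field; lra).
      apply Rmult_le_compat_l; auto.
      apply Rmult_le_pos; [lra|left; apply Rinv_0_lt_compat; lra]. }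
  set (r1 := (W (z0 + k) - W z0 - w z0 * k)%C) in *.
  assert (EF : F z0 = (Cconj v * v + Cconj v / k / z0 * (r1 - (W k - W 0)))%C).
  { rewrite HF1, HQ by auto; unfold r1, v; field; auto. }
  assert (HR : Re (F z0) >= Cmod v ^ 2 - Cmod v / k / Cmod z0 * (e * k + e * k)).
  { rewrite EF, <- Cmod_conj.
    set (r2 := (Cconj v / k / z0 * (r1 - (W k - W 0)))%C).
    assert (Hr2 : Cmod r2 <= Cmod v / k / Cmod z0 * (e * k + e * k)).
    { unfold r2; rewrite Cmod_mult, !Cmod_div, Cmod_conj, Cmod_R, Rabs_pos_eq by (auto; lra).
      apply Rmult_le_compat_l.
      - apply Rlt_le; repeat apply Rdiv_lt_0_compat; auto.
      - eapply Rle_trans; [apply Cmod_triangle|]; rewrite Cmod_opp; lra. }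
    rewrite Cmod_conj, Cmod2_alt.
    replace (Re (Cconj v * v + r2)%C) with (Re v ^ 2 + Im v ^ 2 + Re r2)
      by (unfold Re, Im; simpl; ring).
    generalize (Re_Cmod_bounds r2); lra. }
  replace (Cmod v / k / Cmod z0 * (e * k + e * k)) with (Cmod v * (2 * e / Cmod z0)) in HR by (field; lra).
  replace (Cmod v * (1 + e) / s) with (Cmod v * ((1 + e) / s)) in Hmax by (field; lra).
  assert (Hdiv : Cmod v <= (1 + e) / s + 2 * e / Cmod z0).
  { apply (Rmult_le_reg_l (Cmod v)); auto; lra. }
  apply (Rmult_le_compat_r (s * Cmod z0)) in Hdiv; [|nra].
  replace (((1 + e) / s + 2 * e / Cmod z0) * (s * Cmod z0)) with ((1 + e) * Cmod z0 + 2 * e * s) in Hdiv by (field; lra).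
  exact Hdiv. }
assert (H1 : forall s, Cmod z0 <= s < 1 -> Cmod v * (s * Cmod z0) <= Cmod z0).
{ intros s Hs; apply le_epsilon; intros e He.
  specialize (Hmain s (e / 3) Hs ltac:(lra)); nra. }
rewrite <- Hvm; apply Rnot_lt_le; intros Hlt.
assert (Hv1 : 1 < Cmod v) by nra.
assert (Hi : / Cmod v < 1) by (rewrite <- Rinv_1; apply Rinv_lt_contravar; lra).
assert (Hi0 : 0 < / Cmod v) by (apply Rinv_0_lt_compat; lra).
assert (Hiv : Cmod v * / Cmod v = 1) by (apply Rinv_r; lra).
(* If [|v| > 1], this [s] gives [|v| s >= (|v| + 1) / 2 > 1], against [H1]. *)
set (s := Rmax (Cmod z0) ((1 + / Cmod v) / 2)).
assert (Hs : Cmod z0 <= s < 1) by (split; [apply Rmax_l|apply Rmax_lub_lt; lra]).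
specialize (H1 s Hs).
assert ((1 + / Cmod v) / 2 <= s) by apply Rmax_r.
assert (1 < Cmod v * s) by nra.
nra.
Qed.

Lemma holomorphic_of_lin_approx (U : C -> Prop) (f : C -> C) :
  (forall z, U z -> exists A, lin_approx f z A) -> holomorphic_on U f.
Proof. intros H z Hz; destruct (H z Hz) as [A HA]; exists A; now apply is_derive_C_lin_approx. Qed.

Lemma lin_approx_affine a b z : lin_approx (fun x => a * x + b)%C z a.
Proof.
intros eps He; exists 1; split; [lra|]; intros h _.
replace (a * (z + h) + b - (a * z + b) - a * h)%C with (RtoC 0) by ring.
rewrite Cmod_0; generalize (Cmod_ge_0 h); nra.
Qed.

Lemma mobius_identity (a z : C) :
  Cmod (1 - Cconj a * z)%C ^ 2 - Cmod (z - a)%C ^ 2 = (1 - Cmod a ^ 2) * (1 - Cmod z ^ 2).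
Proof. rewrite !Cmod2_alt; unfold Re, Im; simpl; ring. Qed.

Lemma mobius_denom_ge (a z : C) : 1 - Cmod a * Cmod z <= Cmod (1 - Cconj a * z)%C.
Proof.
generalize (Cmod_sub_rev 1 (Cconj a * z)%C); rewrite Cmod_1, Cmod_mult, Cmod_conj; lra.
Qed.

Lemma mobius_denom_pos (a z : C) : Cmod a < 1 -> Cmod z < 1 -> 0 < Cmod (1 - Cconj a * z)%C.
Proof.
intros Ha Hz; generalize (mobius_denom_ge a z) (Cmod_ge_0 a) (Cmod_ge_0 z); nra.
Qed.

Lemma mobius_lt (a z : C) : Cmod a < 1 -> Cmod z < 1 -> Cmod (z - a)%C < Cmod (1 - Cconj a * z)%C.
Proof.
intros Ha Hz; generalize (mobius_identity a z) (Cmod_ge_0 a) (Cmod_ge_0 z) (Cmod_ge_0 (z - a)%C)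
 (Cmod_ge_0 (1 - Cconj a * z)%C); intros.
assert (0 < (1 - Cmod a ^ 2) * (1 - Cmod z ^ 2)) by (apply Rmult_lt_0_compat; nra).
nra.
Qed.

Lemma Cmod_pos_neq_0 (z : C) : 0 < Cmod z -> z <> 0%C.
Proof. apply (Cmod_gt_0 z). Qed.

(** Schwarz's lemma for [F] placed between two disk automorphisms: [T] carries 0 to [a] and [z0] to
    [b], and the outer one carries [F a] to 0. *)
Lemma schwarz_pick (F : C -> C) (a b : C) : holomorphic_on (Disk 1) F ->
  (forall z, Disk 1 z -> Cmod (F z) < 1) -> Disk 1 a -> Disk 1 b ->
  Cmod (F b - F a)%C * Cmod (1 - Cconj a * b)%C
   <= Cmod (b - a)%C * Cmod (1 - Cconj (F a) * F b)%C.
Proof.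
intros HF HF1 Ha Hb; unfold Disk in *.
set (T := fun z => ((1 * z + a) / (Cconj a * z + 1))%C).
assert (Hden : forall z : C, Cmod z < 1 -> 0 < Cmod (Cconj a * z + 1)%C).
{ intros z Hz; replace (Cconj a * z + 1)%C with (1 - Cconj (- a) * z)%C by (rewrite Copp_conj; ring).
  apply mobius_denom_pos; auto; now rewrite Cmod_opp. }
assert (HT : forall z : C, Cmod z < 1 -> Cmod (T z) < 1).
{ intros z Hz; unfold T; rewrite Cmod_div by (apply Cmod_pos_neq_0; auto).
  apply Rlt_div_l; [apply Hden; auto|]; rewrite Rmult_1_l.
  replace (Cconj a * z + 1)%C with (1 - Cconj (- a) * z)%C by (rewrite Copp_conj; ring).
  replace (1 * z + a)%C with (z - (- a))%C by ring.
  apply mobius_lt; auto; now rewrite Cmod_opp. }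
set (w := fun z => ((1 * F (T z) + - F a) / (- Cconj (F a) * F (T z) + 1))%C).
assert (Hdw : forall u : C, Cmod u < 1 -> 0 < Cmod (- Cconj (F a) * u + 1)%C).
{ intros u Hu; replace (- Cconj (F a) * u + 1)%C with (1 - Cconj (F a) * u)%C by ring.
  apply mobius_denom_pos; auto. }
assert (HT0 : T 0%C = a).
{ unfold T; replace (Cconj a * 0 + 1)%C with (RtoC 1) by ring; field. }
set (z0 := ((b - a) / (1 - Cconj a * b))%C).
assert (Hab := mobius_denom_pos a b Ha Hb).
assert (Hz0 : Cmod z0 < 1).
{ unfold z0; rewrite Cmod_div by (apply Cmod_pos_neq_0; auto).
  apply Rlt_div_l; [lra|]; rewrite Rmult_1_l; apply mobius_lt; auto. }
assert (HTz0 : T z0 = b).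
{ unfold T, z0.
  assert (H1 : (1 - Cconj a * b)%C <> 0%C) by (apply Cmod_pos_neq_0; auto).
  assert (H2 : (1 - Cconj a * a)%C <> 0%C) by (apply Cmod_pos_neq_0, mobius_denom_pos; auto).
  field; split; auto.
  intros E; apply H2; rewrite <- E; ring. }
assert (Hw : Cmod (w z0) <= Cmod z0).
{ apply schwarz; auto.
  - apply holomorphic_of_lin_approx; intros z Hz.
    assert (HTl : exists D, lin_approx T z D).
    { refine (lin_approx_div (fun z => 1 * z + a)%C (fun z => Cconj a * z + 1)%C z _ _ _
        (lin_approx_affine _ _ _) (lin_approx_affine _ _ _)).
      apply Cmod_pos_neq_0; auto. }
    destruct HTl as [D HD].
    destruct (holomorphic_lin_approx _ _ (T z) HF) as [E HE]; [apply HT; auto|].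
    assert (HFT := lin_approx_comp F T z E D HE HD).
    refine (lin_approx_div (fun z => (1 * F (T z) + - F a)%C) (fun z => (- Cconj (F a) * F (T z) + 1)%C) z _ _ _ _ _).
    + apply Cmod_pos_neq_0, Hdw, HF1, HT; auto.
    + exact (lin_approx_comp (fun x => 1 * x + - F a)%C (fun z => F (T z)) z _ _ (lin_approx_affine _ _ _) HFT).
    + exact (lin_approx_comp (fun x => - Cconj (F a) * x + 1)%C (fun z => F (T z)) z _ _ (lin_approx_affine _ _ _) HFT).
  - intros z Hz; unfold w; rewrite Cmod_div by (apply Cmod_pos_neq_0, Hdw, HF1, HT; auto).
    apply Rle_div_l; [apply Hdw, HF1, HT; auto|]; rewrite Rmult_1_l.
    replace (- Cconj (F a) * F (T z) + 1)%C with (1 - Cconj (F a) * F (T z))%C by ring.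
    replace (1 * F (T z) + - F a)%C with (F (T z) - F a)%C by ring.
    left; apply mobius_lt; [auto|apply HF1, HT; auto].
  - unfold w; rewrite HT0; unfold Cdiv; ring. }
unfold w, z0 in Hw; fold z0 in Hw; rewrite HTz0 in Hw; unfold z0 in Hw.
rewrite !Cmod_div in Hw by (apply Cmod_pos_neq_0; auto).
replace (- Cconj (F a) * F b + 1)%C with (1 - Cconj (F a) * F b)%C in Hw by ring.
replace (1 * F b + - F a)%C with (F b - F a)%C in Hw by ring.
assert (HFab := mobius_denom_pos (F a) (F b) (HF1 a Ha) (HF1 b Hb)).
apply (Rmult_le_compat_r (Cmod (1 - Cconj (F a) * F b)%C * Cmod (1 - Cconj a * b)%C)) in Hw; [|nra].
replace (Cmod (F b - F a)%C / Cmod (1 - Cconj (F a) * F b)%C * (Cmod (1 - Cconj (F a) * F b)%C * Cmod (1 - Cconj a * b)%C))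
  with (Cmod (F b - F a)%C * Cmod (1 - Cconj a * b)%C) in Hw by (field; lra).
replace (Cmod (b - a)%C / Cmod (1 - Cconj a * b)%C * (Cmod (1 - Cconj (F a) * F b)%C * Cmod (1 - Cconj a * b)%C))
  with (Cmod (b - a)%C * Cmod (1 - Cconj (F a) * F b)%C) in Hw by (field; lra).
exact Hw.
Qed.

(** * Fixed points and the inverse of [z P(z)] *)

Definition pseudo_dist (a b : C) : R := Cmod (b - a)%C / Cmod (1 - Cconj a * b)%C.

(** Schwarz-Pick applies to [F / l] for any [l] strictly between [k] and 1. Multiplying back by [l]
    brings the factor [2 l / (1 + l^2) < 1], which depends on [k] alone. *)
Lemma pseudo_dist_contract (k : R) : 0 <= k < 1 -> exists c, 0 <= c < 1 /\
  forall F, holomorphic_on (Disk 1) F -> (forall z, Disk 1 z -> Cmod (F z) <= k) ->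
  forall a b, Disk 1 a -> Disk 1 b -> pseudo_dist (F a) (F b) <= c * pseudo_dist a b.
Proof.
intros Hk; set (l := (1 + k) / 2).
assert (Hl : k < l < 1 /\ 0 < l) by (unfold l; lra); clearbody l.
exists (2 * l / (1 + l ^ 2)); split.
{ split; [apply Rdiv_le_0_compat; nra|apply Rlt_div_l; nra]. }
intros F HF HFk a b Ha Hb.
assert (Hl0 : RtoC l <> 0%C) by (apply Cmod_pos_neq_0; rewrite Cmod_R, Rabs_pos_eq; lra).
assert (HP := schwarz_pick (fun z => (/ l * F z + 0)%C) a b).
assert (HG : forall z, Disk 1 z -> Cmod (/ l * F z + 0)%C < 1).
{ intros z Hz; replace (/ l * F z + 0)%C with (F z / l)%C by (field; auto).
  rewrite Cmod_div, Cmod_R, Rabs_pos_eq by (auto; lra).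
  apply Rlt_div_l; [lra|]; specialize (HFk z Hz); lra. }
specialize (HP ltac:(apply holomorphic_of_lin_approx; intros z Hz;
  destruct (holomorphic_lin_approx _ _ z HF Hz) as [D HD]; eexists;
  exact (lin_approx_comp (fun x => / l * x + 0)%C F z _ _ (lin_approx_affine _ _ _) HD)) HG Ha Hb).
cbv beta in HP.
set (x := (/ l * F a + 0)%C) in *; set (y := (/ l * F b + 0)%C) in *.
assert (Ex : F a = (l * x)%C) by (unfold x; field; auto).
assert (Ey : F b = (l * y)%C) by (unfold y; field; auto).
assert (Hx : Cmod x < 1) by (apply HG; auto).
assert (Hy : Cmod y < 1) by (apply HG; auto).
unfold pseudo_dist; rewrite Ex, Ey.
set (u := (Cconj x * y)%C) in *.
assert (Hu : Cmod u < 1).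
{ unfold u; rewrite Cmod_mult, Cmod_conj; generalize (Cmod_ge_0 x) (Cmod_ge_0 y); nra. }
assert (Eu : (1 - Cconj (l * x) * (l * y))%C = (1 - RtoC (l ^ 2) * u)%C).
{ unfold u; rewrite Cmult_conj; replace (Cconj l) with (RtoC l) by (unfold Cconj, RtoC; simpl; f_equal; ring).
  replace (RtoC (l ^ 2)) with (l * l)%C by (rewrite <- RtoC_mult; f_equal; ring); ring. }
rewrite Eu.
replace (l * y - l * x)%C with (l * (y - x))%C by ring.
rewrite Cmod_mult, Cmod_R, Rabs_pos_eq by lra.
assert (Hden : 0 < Cmod (1 - RtoC (l ^ 2) * u)%C).
{ generalize (Cmod_sub_rev 1 (RtoC (l ^ 2) * u)%C); rewrite Cmod_1, Cmod_mult, Cmod_R, Rabs_pos_eq by nra.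
  generalize (Cmod_ge_0 u); nra. }
(* |1 - l^2 u|^2 = l^2 |1 - u|^2 + (1 - l^2)(1 - l^2 |u|^2), and |1 - u| <= 2 *)
assert (Hratio : (1 + l ^ 2) / 2 * Cmod (1 - u)%C <= Cmod (1 - RtoC (l ^ 2) * u)%C).
{ assert (E : Cmod (1 - RtoC (l ^ 2) * u)%C ^ 2 = l ^ 2 * Cmod (1 - u)%C ^ 2 + (1 - l ^ 2) * (1 - l ^ 2 * Cmod u ^ 2)).
  { rewrite !Cmod2_alt; unfold Re, Im; simpl; ring. }
  assert (H2 : Cmod (1 - u)%C <= 2).
  { eapply Rle_trans; [apply Cmod_triangle|]; rewrite Cmod_opp, Cmod_1; lra. }
  generalize (Cmod_ge_0 u) (Cmod_ge_0 (1 - u)%C); intros U1 U2.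
  assert (U3 : Cmod u ^ 2 <= 1) by nra.
  assert (U4 : Cmod (1 - u)%C ^ 2 <= 4) by nra.
  assert (U5 : (1 - l ^ 2) * (1 - l ^ 2) <= (1 - l ^ 2) * (1 - l ^ 2 * Cmod u ^ 2)).
  { apply Rmult_le_compat_l; nra. }
  assert (U6 : (1 - l ^ 2) * (1 - l ^ 2) * Cmod (1 - u)%C ^ 2 <= (1 - l ^ 2) * (1 - l ^ 2) * 4).
  { apply Rmult_le_compat_l; auto; apply Rle_0_sqr. }
  apply Rsqr_incr_0_var; [|lra].
  unfold Rsqr; nra. }
assert (Hab := mobius_denom_pos a b Ha Hb).
apply Rle_div_l; auto.
replace (2 * l / (1 + l ^ 2) * (Cmod (b - a)%C / Cmod (1 - Cconj a * b)%C) * Cmod (1 - RtoC (l ^ 2) * u)%C)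
 with ((2 * l / (1 + l ^ 2) * Cmod (b - a)%C * Cmod (1 - RtoC (l ^ 2) * u)%C) / Cmod (1 - Cconj a * b)%C) by (field; split; nra).
apply (proj1 (Rle_div_r _ _ _ Hab)).
apply Rle_trans with (l * (Cmod (b - a)%C * Cmod (1 - u)%C)).
- rewrite Rmult_assoc; apply Rmult_le_compat_l; lra.
- apply Rle_trans with (2 * l / (1 + l ^ 2) * Cmod (b - a)%C * ((1 + l ^ 2) / 2 * Cmod (1 - u)%C)).
  + right; field; nra.
  + apply Rmult_le_compat_l; auto.
    apply Rmult_le_pos; [apply Rdiv_le_0_compat; nra|apply Cmod_ge_0].
Qed.

(** The iteration may start at any [y]; its limit lies within a multiple of the first step
    [|F y - y|], and contraction forces all these limits to coincide, so the bound holds for every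
    [y]. Steps shrink pseudo-hyperbolically but are summed in the Euclidean metric: [Hpd1] compares
    the two in one direction, [Hpd2] in the other where [|a| |b| <= k]. That [L] precedes [F] makes
    it uniform in the parameter [w] later. *)
Lemma holomorphic_fixed_point (k : R) : 0 <= k < 1 -> exists L, forall F,
  holomorphic_on (Disk 1) F -> (forall z, Disk 1 z -> Cmod (F z) <= k) ->
  exists x, Cmod x <= k /\ F x = x /\ forall y, Disk 1 y -> Cmod (x - y)%C <= L * Cmod (F y - y)%C.
Proof.
intros Hk; destruct (pseudo_dist_contract k Hk) as [c [Hc Hcon]].
exists (2 / (1 - k) / (1 - c)); intros F HF HFk.
specialize (Hcon F HF HFk).
assert (HD : forall z, Disk 1 z -> Disk 1 (F z)).
{ intros z Hz; specialize (HFk z Hz); unfold Disk; lra. }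
assert (Hpd0 : forall a b, Disk 1 a -> Disk 1 b -> 0 <= pseudo_dist a b).
{ intros a b Ha Hb; apply Rdiv_le_0_compat; [apply Cmod_ge_0|apply mobius_denom_pos; auto]. }
assert (Hpd1 : forall a b, Disk 1 a -> Disk 1 b -> Cmod (b - a)%C <= 2 * pseudo_dist a b).
{ intros a b Ha Hb; unfold pseudo_dist.
  assert (Hm := mobius_denom_pos a b Ha Hb).
  assert (H2 : Cmod (1 - Cconj a * b)%C <= 2).
  { eapply Rle_trans; [apply Cmod_triangle|]; rewrite Cmod_opp, Cmod_1, Cmod_mult, Cmod_conj.
    unfold Disk in *; generalize (Cmod_ge_0 a) (Cmod_ge_0 b); nra. }
  replace (2 * (Cmod (b - a)%C / Cmod (1 - Cconj a * b)%C)) with (2 * Cmod (b - a)%C / Cmod (1 - Cconj a * b)%C) by (field; lra).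
  apply Rle_div_r; auto; generalize (Cmod_ge_0 (b - a)%C); nra. }
assert (Hpd2 : forall a b, Disk 1 a -> Disk 1 b -> Cmod a * Cmod b <= k ->
  pseudo_dist a b <= Cmod (b - a)%C / (1 - k)).
{ intros a b Ha Hb Hab; unfold pseudo_dist, Rdiv.
  apply Rmult_le_compat_l; [apply Cmod_ge_0|]; apply Rinv_le_contravar; [lra|].
  generalize (mobius_denom_ge a b); lra. }
assert (Hex : forall y, Disk 1 y -> exists x, Cmod x <= k /\ F x = x /\
   Cmod (x - y)%C <= 2 / (1 - k) / (1 - c) * Cmod (F y - y)%C).
{ intros y Hy.
  set (t := fun n => Nat.iter n F y).
  assert (Ht : forall n, Disk 1 (t n)) by (induction n; [exact Hy|apply HD; exact IHn]).
  assert (Hd : forall n, pseudo_dist (t n) (t (S n)) <= pseudo_dist y (F y) * c ^ n).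
  { induction n as [|n IH]; [simpl; lra|].
    eapply Rle_trans; [apply (Hcon (t n) (t (S n))); auto|].
    rewrite <- tech_pow_Rmult; nra. }
  assert (Hy0 := Hpd0 y (F y) Hy (HD y Hy)).
  destruct (geometric_limit t (2 * pseudo_dist y (F y)) c Hc) as [x [Hx1 Hx2]]; [lra| |].
  { intros n; eapply Rle_trans; [apply Hpd1; auto|]; specialize (Hd n); lra. }
  assert (Hxk : Cmod x <= k).
  { apply le_epsilon; intros e He; destruct (Hx2 e He) as [N HN].
    specialize (HN (S N) ltac:(lia)); generalize (Cmod_sub_rev x (t (S N))) (HFk (t N) (Ht N)).
    change (F (t N)) with (t (S N)); lra. }
  assert (Hx : Disk 1 x) by (unfold Disk; lra).
  exists x; split; [auto|split].
  - assert (E : Cmod (F x - x)%C <= 0).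
    { apply le_epsilon; intros e He; rewrite Rplus_0_l.
      assert (HK : 0 < 2 / (1 - k) + 1) by (assert (0 < 2 / (1 - k)) by (apply Rdiv_lt_0_compat; lra); lra).
      destruct (Hx2 (e / (2 / (1 - k) + 1))) as [N HN]; [apply Rdiv_lt_0_compat; auto|].
      assert (HN1 := HN N (le_n N)); assert (HN2 := HN (S N) ltac:(lia)).
      replace (F x - x)%C with (- ((x - t (S N)) + (t (S N) - F x)))%C by ring; rewrite Cmod_opp.
      eapply Rle_trans; [apply Cmod_triangle|].
      assert (H1 : Cmod (t (S N) - F x)%C <= 2 / (1 - k) * Cmod (x - t N)%C).
      { change (t (S N)) with (F (t N)).
        eapply Rle_trans; [apply Hpd1; auto|].
        assert (H3 : pseudo_dist x (t N) <= Cmod (t N - x)%C / (1 - k)).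
        { apply Hpd2; auto; generalize (Cmod_ge_0 x) (Cmod_ge_0 (t N)) (Ht N); unfold Disk; nra. }
        specialize (Hcon x (t N) Hx (Ht N)); specialize (Hpd0 x (t N) Hx (Ht N)).
        rewrite (Cmod_sub_comm x (t N)).
        replace (2 / (1 - k) * Cmod (t N - x)%C) with (2 * (Cmod (t N - x)%C / (1 - k))) by (field; lra).
        nra. }
      set (K := 2 / (1 - k)) in *.
      assert (Er : e / (K + 1) * (K + 1) = e) by (field; lra).
      assert (0 < K) by (unfold K; apply Rdiv_lt_0_compat; lra).
      nra. }
    assert (E0 : (F x - x)%C = 0%C) by (apply Cmod_eq_0, Rle_antisym; [auto|apply Cmod_ge_0]).
    replace (F x) with ((F x - x) + x)%C by ring; rewrite E0; ring.
  - specialize (Hx1 O); change (t O) with y in Hx1; rewrite pow_O in Hx1.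
    eapply Rle_trans; [exact Hx1|].
    assert (H3 : pseudo_dist y (F y) <= Cmod (F y - y)%C / (1 - k)).
    { apply Hpd2; auto; generalize (Cmod_ge_0 y) (HFk y Hy) (Cmod_ge_0 (F y)); unfold Disk in Hy; nra. }
    replace (2 / (1 - k) / (1 - c) * Cmod (F y - y)%C) with (2 * (Cmod (F y - y)%C / (1 - k)) * 1 / (1 - c)) by (field; lra).
    unfold Rdiv; apply Rmult_le_compat_r; [left; apply Rinv_0_lt_compat; lra|]; unfold Rdiv in H3; lra. }
destruct (Hex 0%C) as [x [Hxk [Hx _]]]; [unfold Disk; rewrite Cmod_0; lra|].
exists x; split; [auto|split; [auto|]]; intros y Hy.
destruct (Hex y Hy) as [x' [Hxk' [Hx' Hd]]].
assert (Dx : Disk 1 x) by (unfold Disk; lra); assert (Dx' : Disk 1 x') by (unfold Disk; lra).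
specialize (Hcon x' x Dx' Dx); rewrite Hx, Hx' in Hcon.
specialize (Hpd0 x' x Dx' Dx); specialize (Hpd1 x' x Dx' Dx).
replace x with x'; auto.
assert (Hz : Cmod (x - x')%C <= 0) by nra.
assert (E : (x - x')%C = 0%C) by (apply Cmod_eq_0, Rle_antisym; [auto|apply Cmod_ge_0]).
replace x with ((x - x') + x')%C by ring; rewrite E; ring.
Qed.

(** After rescaling to the unit disk, [w / (s P(s z))] has modulus at most [k]. It moves [y / s] by
    [(y P(y) - w) / (s P(y))] up to sign, so the fixed-point estimate becomes a bound by the
    residual of the equation. *)
Lemma solve_mult_eq (s rh k : R) (P : C -> C) : 0 < s -> 0 < rh -> 0 <= k < 1 ->
  holomorphic_on (Disk s) P -> (forall z, Disk s z -> rh <= s * Cmod (P z)) ->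
  exists L, forall w, Cmod w <= k * rh -> exists x, Cmod x <= k * s /\ (x * P x)%C = w /\
    forall y, Disk s y -> Cmod (x - y)%C <= L * Cmod (y * P y - w)%C.
Proof.
intros Hs Hrh Hk HP Hb.
destruct (holomorphic_fixed_point k Hk) as [L HL].
exists (s * (Rabs L / rh)); intros w Hw.
assert (Hs0 : RtoC s <> 0%C) by (apply Cmod_pos_neq_0; rewrite Cmod_R, Rabs_pos_eq; lra).
assert (Hms : Cmod s = s) by (rewrite Cmod_R, Rabs_pos_eq; lra).
assert (HDs : forall z, Disk 1 z -> Disk s (s * z + 0)%C).
{ intros z Hz; unfold Disk in *; replace (s * z + 0)%C with (s * z)%C by ring; rewrite Cmod_mult, Hms; nra. }
assert (HP0 : forall z, Disk s z -> P z <> 0%C).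
{ intros z Hz; apply Cmod_pos_neq_0; specialize (Hb z Hz); generalize (Cmod_ge_0 (P z)); nra. }
destruct (HL (fun z => w / (s * P (s * z + 0) + 0))%C) as [x [Hx1 [Hx2 Hx3]]].
- apply holomorphic_of_lin_approx; intros z Hz.
  destruct (holomorphic_lin_approx _ _ _ HP (HDs z Hz)) as [D HD].
  refine (lin_approx_div (fun _ => w) (fun z => s * P (s * z + 0) + 0)%C z _ _ _ (lin_approx_const _ _) _).
  + replace (s * P (s * z + 0) + 0)%C with (s * P (s * z + 0))%C by ring; apply Cmult_neq_0; auto.
  + exact (lin_approx_comp (fun x => s * x + 0)%C (fun z => P (s * z + 0)%C) z _ _ (lin_approx_affine _ _ _)
      (lin_approx_comp P (fun z => s * z + 0)%C z _ _ HD (lin_approx_affine _ _ _))).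
- intros z Hz; replace (s * P (s * z + 0) + 0)%C with (s * P (s * z + 0))%C by ring.
  specialize (Hb _ (HDs z Hz)).
  rewrite Cmod_div, Cmod_mult, Hms by (apply Cmult_neq_0; auto).
  apply Rle_div_l; [lra|]; nra.
- assert (Hx : Disk 1 x) by (unfold Disk; lra).
  assert (E0 : forall z : C, (s * z + 0)%C = (s * z)%C) by (intros; ring).
  exists (s * x)%C; split; [rewrite Cmod_mult, Hms; nra|].
  specialize (HDs x Hx); rewrite !E0 in Hx2; rewrite E0 in HDs; split.
  + specialize (HP0 _ HDs); set (u := P (s * x)%C) in *; clearbody u.
    rewrite <- Hx2; field; split; auto.
  + intros y Hy.
    assert (Hy' : Disk 1 (y / s)%C).
    { unfold Disk in *; rewrite Cmod_div, Hms by auto; apply Rlt_div_l; lra. }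
    specialize (Hx3 _ Hy'); rewrite !E0 in Hx3.
    replace (s * (y / s))%C with y in Hx3 by (field; auto).
    replace (w / (s * P y) - y / s)%C with (- ((y * P y - w) / (s * P y)))%C in Hx3
      by (field; split; auto).
    rewrite Cmod_opp, Cmod_div, Cmod_mult, Hms in Hx3 by (apply Cmult_neq_0; auto).
    replace (s * x - y)%C with (s * (x - y / s))%C by (field; auto).
    rewrite Cmod_mult, Hms, Rmult_assoc; apply Rmult_le_compat_l; [lra|].
    eapply Rle_trans; [exact Hx3|].
    unfold Rdiv; rewrite Rmult_assoc.
    specialize (Hb y Hy); generalize (Cmod_ge_0 (y * P y - w)%C); intros Hn.
    assert (Hi : / (s * Cmod (P y)) <= / rh) by (apply Rinv_le_contravar; auto).
    assert (Hi0 : 0 < / (s * Cmod (P y))) by (apply Rinv_0_lt_compat; lra).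
    eapply Rle_trans; [apply Rmult_le_compat_r; [|apply Rle_abs]|].
    * apply Rmult_le_pos; lra.
    * apply Rmult_le_compat_l; [apply Rabs_pos|]; rewrite Rmult_comm; apply Rmult_le_compat_r; auto.
Qed.

(** The residual bound of [solve_mult_eq] does three things: at another solution [y] it gives
    uniqueness, at [y = g w0] the Lipschitz bound for [g], and at [y] near [g w0] a nonzero
    derivative of [z P(z)]. *)
Lemma inverse_mult_eq (s rh : R) (P : C -> C) : 0 < s -> 0 < rh ->
  holomorphic_on (Disk s) P -> (forall z, Disk s z -> rh <= s * Cmod (P z)) ->
  exists g : C -> C, holomorphic_on (Disk rh) g /\
    (forall w, Disk rh w -> Disk s (g w) /\ (g w * P (g w))%C = w) /\
    (forall z, Disk s z -> Disk rh (z * P z)%C -> g (z * P z)%C = z).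
Proof.
intros Hs Hrh HP Hb.
assert (Hsol : forall k, 0 <= k < 1 -> exists L, forall w, Cmod w <= k * rh ->
  exists x, Disk s x /\ (x * P x)%C = w /\
    forall y, Disk s y -> Cmod (x - y)%C <= L * Cmod (y * P y - w)%C).
{ intros k Hk; destruct (solve_mult_eq s rh k P Hs Hrh Hk HP Hb) as [L HL]; exists L.
  intros w Hw; destruct (HL w Hw) as [x [H1 H2]]; exists x; split; auto; unfold Disk; nra. }
assert (Hloc : forall w0, Disk rh w0 -> exists d L, 0 < d /\ forall w, Cmod (w - w0)%C < d ->
  Disk rh w /\
  exists x, Disk s x /\ (x * P x)%C = w /\
    forall y, Disk s y -> Cmod (x - y)%C <= L * Cmod (y * P y - w)%C).
{ intros w0 Hw0; unfold Disk in *.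
  (* The midpoint between [|w0| / rh] and 1 leaves room for a ball around [w0] with one common
     [L]. *)
  set (k := (Cmod w0 / rh + 1) / 2).
  assert (Hq : Cmod w0 / rh < 1) by (apply Rlt_div_l; lra).
  assert (Hq0 : 0 <= Cmod w0 / rh) by (apply Rdiv_le_0_compat; [apply Cmod_ge_0|auto]).
  assert (Hkr : k * rh = (Cmod w0 + rh) / 2) by (unfold k; field; lra).
  destruct (Hsol k) as [L HL]; [unfold k; lra|].
  exists ((rh - Cmod w0) / 2), L; split; [lra|]; intros w Hw.
  generalize (Cmod_sub_rev w w0); intros; split; [lra|]; apply HL; lra. }
assert (Hex : forall w, exists x, Disk rh w -> Disk s x /\ (x * P x)%C = w).
{ intros w; destruct (classic (Disk rh w)) as [Hw|Hw]; [|exists 0%C; tauto].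
  destruct (Hloc w Hw) as [d [L [Hd H]]].
  destruct (H w) as [_ [x [H1 [H2 _]]]]; [replace (w - w)%C with (RtoC 0) by ring; rewrite Cmod_0; auto|].
  exists x; auto. }
set (g := fun w => proj1_sig (constructive_indefinite_description _ (Hex w))).
assert (Hg : forall w, Disk rh w -> Disk s (g w) /\ (g w * P (g w))%C = w).
{ intros w; exact (proj2_sig (constructive_indefinite_description _ (Hex w))). }
assert (Hlip : forall w0, Disk rh w0 -> exists d L, 0 < d /\ 0 < L /\ forall w, Cmod (w - w0)%C < d ->
  Disk rh w /\ forall y, Disk s y -> Cmod (g w - y)%C <= L * Cmod (y * P y - w)%C).
{ intros w0 Hw0; destruct (Hloc w0 Hw0) as [d [L [Hd H]]].
  exists d, (Rabs L + 1); split; [auto|split; [generalize (Rabs_pos L); lra|]]; intros w Hw.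
  destruct (H w Hw) as [Hr [x [H1 [H2 H3]]]]; split; auto.
  destruct (Hg w Hr) as [G1 G2].
  replace (g w) with x.
  - intros y Hy; eapply Rle_trans; [apply H3; auto|].
    apply Rmult_le_compat_r; [apply Cmod_ge_0|]; generalize (Rle_abs L); lra.
  - specialize (H3 _ G1); rewrite G2 in H3.
    replace (w - w)%C with (RtoC 0) in H3 by ring; rewrite Cmod_0, Rmult_0_r in H3.
    assert (E : (x - g w)%C = 0%C) by (apply Cmod_eq_0, Rle_antisym; [auto|apply Cmod_ge_0]).
    replace x with ((x - g w) + g w)%C by ring; rewrite E; ring. }
assert (Hinv : forall z, Disk s z -> Disk rh (z * P z)%C -> g (z * P z)%C = z).
{ intros z Hz Hw; destruct (Hlip _ Hw) as [d [L [Hd [HL H]]]].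
  assert (E1 : (z * P z - z * P z)%C = 0%C) by ring.
  destruct (H (z * P z)%C) as [_ H1]; [rewrite E1, Cmod_0; auto|].
  specialize (H1 z Hz); rewrite E1, Cmod_0, Rmult_0_r in H1.
  assert (E : (g (z * P z) - z)%C = 0%C) by (apply Cmod_eq_0, Rle_antisym; [auto|apply Cmod_ge_0]).
  replace (g (z * P z)%C) with ((g (z * P z) - z) + z)%C by ring; rewrite E; ring. }
exists g; split; [|auto].
apply holomorphic_of_lin_approx; intros w0 Hw0.
destruct (Hlip w0 Hw0) as [d [L [Hd [HL H]]]].
destruct (Hg w0 Hw0) as [G1 G2].
set (z0 := g w0) in *.
destruct (holomorphic_lin_approx _ _ _ HP G1) as [D HD].
assert (HH := lin_approx_mult (fun x => x) P z0 _ _ (lin_approx_id z0) HD); cbv beta in HH.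
set (A := (1 * P z0 + z0 * D)%C) in *.
(* The local Lipschitz bound on g rules out a critical point of z P(z) at g(w0). *)
assert (HA : A <> 0%C).
{ intros EA; rewrite EA in HH.
  destruct (HH (/ (2 * L))) as [d1 [Hd1 H1]]; [apply Rinv_0_lt_compat; lra|].
  unfold Disk in *.
  destruct (lin_approx_cont _ _ _ HH d Hd) as [d2 [Hd2 H2]].
  set (t := Rmin d1 (Rmin d2 (s - Cmod z0)) / 2).
  assert (Hm : 0 < Rmin d1 (Rmin d2 (s - Cmod z0))) by (repeat apply Rmin_pos; lra).
  generalize (Rmin_l d1 (Rmin d2 (s - Cmod z0))) (Rmin_r d1 (Rmin d2 (s - Cmod z0)))
   (Rmin_l d2 (s - Cmod z0)) (Rmin_r d2 (s - Cmod z0)); intros M1 M2 M3 M4.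
  assert (Ht : 0 < t /\ t < d1 /\ t < d2 /\ t < s - Cmod z0) by (unfold t; lra).
  clearbody t; destruct Ht as [T0 [T1 [T2 T3]]].
  assert (Et : Cmod t = t) by (rewrite Cmod_R, Rabs_pos_eq; lra).
  specialize (H1 t ltac:(rewrite Et; lra)); specialize (H2 t ltac:(rewrite Et; lra)); cbv beta in H2.
  assert (Hzt : Cmod (z0 + t)%C < s).
  { eapply Rle_lt_trans; [apply Cmod_triangle|]; rewrite Et; lra. }
  rewrite G2 in H1, H2.
  destruct (H w0) as [_ H3]; [replace (w0 - w0)%C with (RtoC 0) by ring; rewrite Cmod_0; auto|].
  specialize (H3 (z0 + t)%C Hzt); fold z0 in H3.
  replace (z0 - (z0 + t))%C with (- RtoC t)%C in H3 by ring.
  replace ((z0 + t) * P (z0 + t) - w0 - 0 * t)%C with ((z0 + t) * P (z0 + t) - w0)%C in H1 by ring.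
  rewrite Cmod_opp, Et in H3; rewrite Et in H1.
  apply (Rmult_le_compat_l L) in H1; [|lra].
  replace (L * (/ (2 * L) * t)) with (t / 2) in H1 by (field; lra); lra. }
assert (HmA : 0 < Cmod A) by exact (proj1 (Cmod_gt_0 A) HA).
exists (/ A)%C; intros eps He.
(* With [|z - z0| <= L |h|] this error becomes [eps |A| |h|], and dividing by [A] leaves
   [eps |h|]. *)
destruct (HH (eps * Cmod A / L)) as [d1 [Hd1 H1]].
{ apply Rdiv_lt_0_compat; auto; nra. }
exists (Rmin d (d1 / L)); split; [apply Rmin_pos; auto; now apply Rdiv_lt_0_compat|].
intros h Hh.
assert (Hh1 : Cmod h < d) by (eapply Rlt_le_trans; [exact Hh|apply Rmin_l]).
assert (Hh2 : Cmod h < d1 / L) by (eapply Rlt_le_trans; [exact Hh|apply Rmin_r]).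
apply Rlt_div_r in Hh2; auto.
destruct (H (w0 + h)%C) as [Hwh Hgh]; [replace (w0 + h - w0)%C with h by ring; auto|].
destruct (Hg _ Hwh) as [K1 K2].
specialize (Hgh z0 G1); rewrite G2 in Hgh.
replace (w0 - (w0 + h))%C with (- h)%C in Hgh by ring; rewrite Cmod_opp in Hgh.
fold z0; set (z := g (w0 + h)%C) in *.
specialize (H1 (z - z0)%C ltac:(lra)).
replace (z0 + (z - z0))%C with z in H1 by ring.
rewrite K2, G2 in H1.
replace (w0 + h - w0 - A * (z - z0))%C with (h - A * (z - z0))%C in H1 by ring.
replace (z - z0 - / A * h)%C with (- ((h - A * (z - z0)) / A))%C by (field; auto).
rewrite Cmod_opp, Cmod_div by auto.
apply Rle_div_l; auto.
eapply Rle_trans; [exact H1|].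
apply Rle_trans with (eps * Cmod A / L * (L * Cmod h)).
- apply Rmult_le_compat_l; auto; apply Rlt_le, Rdiv_lt_0_compat; auto; nra.
- right; field; lra.
Qed.

(** * Growth estimates *)

Lemma caratheodory_growth (q : C) (p : C -> C) : 0 < Re q -> holomorphic_on (Disk 1) p ->
  (forall z, Disk 1 z -> 0 <= Re (p z)) -> p 0%C = q ->
  forall z, Disk 1 z -> Cmod (p z - q)%C ^ 2 <= Cmod z ^ 2 * Cmod (p z + Cconj q)%C ^ 2.
Proof.
intros Hq Hp Hre H0 z Hz.
assert (Hden : forall z, Disk 1 z -> 0 < Cmod (1 * p z + Cconj q)%C).
{ intros x Hx; specialize (Hre x Hx).
  eapply Rlt_le_trans; [|apply Re_Cmod_bounds].
  replace (Re (1 * p x + Cconj q)%C) with (Re (p x) + Re q) by (unfold Re, Im; simpl; ring); lra. }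
set (w := fun z => ((1 * p z + - q) / (1 * p z + Cconj q))%C).
assert (Hw : Cmod (w z) <= Cmod z).
{ apply schwarz; auto.
  - apply holomorphic_of_lin_approx; intros x Hx.
    destruct (holomorphic_lin_approx _ _ _ Hp Hx) as [D HD].
    refine (lin_approx_div (fun z => 1 * p z + - q)%C (fun z => 1 * p z + Cconj q)%C x _ _ _ _ _).
    + apply Cmod_pos_neq_0; auto.
    + exact (lin_approx_comp (fun x => 1 * x + - q)%C p x _ _ (lin_approx_affine _ _ _) HD).
    + exact (lin_approx_comp (fun x => 1 * x + Cconj q)%C p x _ _ (lin_approx_affine _ _ _) HD).
  - intros x Hx; unfold w; rewrite Cmod_div by (apply Cmod_pos_neq_0; auto).
    apply Rle_div_l; [apply Hden; auto|]; rewrite Rmult_1_l.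
    (* The difference of the two squares is [4 Re (p x) Re q]. *)
    apply Rsqr_incr_0_var; [|apply Cmod_ge_0].
    rewrite !Rsqr_pow2, !Cmod2_alt.
    specialize (Hre x Hx); generalize (Rmult_le_pos _ _ Hre (Rlt_le _ _ Hq)).
    unfold Re, Im; simpl; nra.
  - unfold w; rewrite H0; unfold Cdiv; ring. }
unfold w in Hw; rewrite Cmod_div in Hw by (apply Cmod_pos_neq_0; auto).
specialize (Hden z Hz); apply Rle_div_l in Hw; auto.
replace (1 * p z + - q)%C with (p z - q)%C in Hw by ring.
replace (1 * p z + Cconj q)%C with (p z + Cconj q)%C in Hw by ring.
rewrite <- Rpow_mult_distr; apply pow_incr; split; [apply Cmod_ge_0|exact Hw].
Qed.

(** The imaginary parts contribute the same square to both sides, on the right with weight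
    [s^2 <= 1], so they drop out and leave [|Re v - Re q| <= s (Re v + Re q)]. *)
Lemma caratheodory_Re_lower (q v : C) (s : R) : 0 < Re q -> 0 <= Re v -> 0 <= s < 1 ->
  Cmod (v - q)%C ^ 2 <= s ^ 2 * Cmod (v + Cconj q)%C ^ 2 ->
  Re q * (1 - s) <= Re v * (1 + s).
Proof.
intros Hq Hv Hs; rewrite !Cmod2_alt; destruct q as [a b], v as [x y]; unfold Re, Im in *; simpl in *.
intros H.
assert (K : (x - a) ^ 2 <= (s * (x + a)) ^ 2).
{ assert (s ^ 2 * (y - b) ^ 2 <= 1 * (y - b) ^ 2) by (apply Rmult_le_compat_r; [apply pow2_ge_0|nra]). nra. }
assert (H1 : - (s * (x + a)) <= x - a); [|lra].
assert (H2 : 0 <= s * (x + a)) by nra.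
nra.
Qed.

(** The Apollonius disk with centre [(q + s^2 Cconj q) / (1 - s^2)] and radius
    [2 s Re q / (1 - s^2)], denominators cleared. *)
Lemma caratheodory_disk (q v : C) (s : R) : 0 < Re q -> 0 <= s < 1 ->
  Cmod (v - q)%C ^ 2 <= s ^ 2 * Cmod (v + Cconj q)%C ^ 2 ->
  Cmod (v * RtoC (1 - s ^ 2) - (q + RtoC (s ^ 2) * Cconj q))%C <= 2 * s * Re q.
Proof.
intros Hq Hs H.
assert (E : Cmod (v * RtoC (1 - s ^ 2) - (q + RtoC (s ^ 2) * Cconj q))%C ^ 2 - (2 * s * Re q) ^ 2
  = (1 - s ^ 2) * (Cmod (v - q)%C ^ 2 - s ^ 2 * Cmod (v + Cconj q)%C ^ 2)).
{ rewrite !Cmod2_alt; destruct q, v; unfold Re, Im; simpl; ring. }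
assert (H1 : 0 <= (1 - s ^ 2)) by nra.
apply Rsqr_incr_0_var; [rewrite !Rsqr_pow2; nra|nra].
Qed.

(** On the disk of [caratheodory_disk], [|1 + r v|] is at most [(X + 2 r s Re q) / (1 - s^2)].
    Requiring this to be below [t], one isolates [X] and squares: the first inequality on [t] is the
    sign condition for squaring, the second is the squared inequality divided by [1 - s^2]. *)
Lemma growth_upper (q v : C) (r s t : R) : 0 < Re q -> 0 < r -> 0 < s < 1 ->
  Cmod (v - q)%C ^ 2 <= s ^ 2 * Cmod (v + Cconj q)%C ^ 2 ->
  2 * (r * Re q) * s < t * (1 - s ^ 2) ->
  4 * (r * Re q) * (t * s + s ^ 2) < (1 - s ^ 2) * (t ^ 2 - Cmod (1 + r * q)%C ^ 2) ->
  Cmod (1 + r * v)%C < t.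
Proof.
intros Hq Hr Hs Hv Ht1 Ht2.
assert (HD := caratheodory_disk q v s Hq ltac:(lra) Hv).
assert (Hs2 : 0 < 1 - s ^ 2) by nra.
set (X := Cmod (RtoC (1 - s ^ 2) + r * (q + RtoC (s ^ 2) * Cconj q))%C).
assert (HX : X < t * (1 - s ^ 2) - 2 * (r * Re q) * s).
{ apply Rsqr_incrst_0; [|apply Cmod_ge_0|lra].
  assert (E : X ^ 2 = (t * (1 - s ^ 2) - 2 * (r * Re q) * s) ^ 2
    - (1 - s ^ 2) * ((1 - s ^ 2) * (t ^ 2 - Cmod (1 + r * q)%C ^ 2) - 4 * (r * Re q) * (t * s + s ^ 2))).
  { unfold X; rewrite !Cmod2_alt; destruct q; unfold Re, Im; simpl; ring. }
  rewrite !Rsqr_pow2, E.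
  assert (0 < (1 - s ^ 2) * ((1 - s ^ 2) * (t ^ 2 - Cmod (1 + r * q)%C ^ 2) - 4 * (r * Re q) * (t * s + s ^ 2)))
    by (apply Rmult_lt_0_compat; lra).
  lra. }
apply (Rmult_lt_reg_r (1 - s ^ 2)); auto.
assert (E : Cmod (1 + r * v)%C * (1 - s ^ 2) =
  Cmod ((RtoC (1 - s ^ 2) + r * (q + RtoC (s ^ 2) * Cconj q)) + r * (v * RtoC (1 - s ^ 2) - (q + RtoC (s ^ 2) * Cconj q)))%C).
{ rewrite <- (Rabs_pos_eq (1 - s ^ 2)) at 1 by lra.
  rewrite <- Cmod_R, <- Cmod_mult; f_equal; ring. }
rewrite E; eapply Rle_lt_trans; [apply Cmod_triangle|]; fold X.
rewrite Cmod_mult, Cmod_R, Rabs_pos_eq by lra.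
apply (Rmult_le_compat_l r) in HD; lra.
Qed.

(** With [x = 1 + s], the function [s (1 + a (1 - s) / (1 + s))] is [3 a - 1 - (a - 1) x - 2 a / x].
    By AM-GM its maximum is at [x = sqrt (2 a / (a - 1))], that is at [s = rh1], with value [rh].
    The bounds [rh <= a / 2] (an equality at [a = 2]) and [1 / 4 < rh1] prepare the covering radius
    [rho2]. *)
Lemma rho_rho1_spec (a : R) : 2 < a ->
  let rh := (sqrt (2 * a) - sqrt (a - 1)) ^ 2 in
  let rh1 := sqrt (2 * a / (a - 1)) - 1 in
  1 < rh /\ rh <= a / 2 /\ 1 / 4 < rh1 < 1 /\ rh1 * (1 + a * ((1 - rh1) / (1 + rh1))) = rh.
Proof.
intros Ha rh rh1.
assert (Eu : sqrt (2 * a) * sqrt (2 * a) = 2 * a) by (apply sqrt_sqrt; lra).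
assert (Ev : sqrt (a - 1) * sqrt (a - 1) = a - 1) by (apply sqrt_sqrt; lra).
assert (Hu : 0 < sqrt (2 * a)) by (apply sqrt_lt_R0; lra).
assert (Hv : 0 < sqrt (a - 1)) by (apply sqrt_lt_R0; lra).
assert (E1 : rh1 = sqrt (2 * a) / sqrt (a - 1) - 1).
{ unfold rh1; rewrite sqrt_div_alt by lra; reflexivity. }
set (u := sqrt (2 * a)) in *; set (v := sqrt (a - 1)) in *.
assert (H1 : v < u) by nra.
assert (H2 : u < 2 * v) by nra.
assert (H3 : 5 / 4 * v < u) by nra.
assert (Hv1 : 1 < v) by nra.
(* Squared twice, this is [0 < (a - 2)^2]. *)
assert (H4 : 1 + v < u) by nra.
split; [unfold rh; nra|].
assert (H5 : 5 / 2 * a - 1 <= 2 * (u * v)).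
{ assert (Huv : 0 < u * v) by nra.
  assert (Euv : (u * v) * (u * v) = 2 * a * (a - 1)) by (rewrite <- Eu, <- Ev; ring).
  assert (H6 : (5 / 4 * a - 1 / 2) ^ 2 <= (u * v) ^ 2) by nra.
  assert (5 / 4 * a - 1 / 2 <= u * v); [|lra].
  apply Rsqr_incr_0_var; [rewrite !Rsqr_pow2; exact H6|lra]. }
split; [unfold rh; nra|].
split.
{ rewrite E1; split.
  - assert (5 / 4 < u / v) by exact (proj1 (Rlt_div_r _ _ _ Hv) H3); lra.
  - assert (u / v < 2) by (apply Rlt_div_l; lra); lra. }
rewrite E1; unfold rh.
replace a with (u * u / 2) by lra.
replace (1 - (u / v - 1)) with ((2 * v - u) / v) by (field; lra).
replace (1 + (u / v - 1)) with (u / v) by (field; lra).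
replace ((u / v - 1) * (1 + u * u / 2 * ((2 * v - u) / v / (u / v))))
  with ((u - v) / v * (1 + u * v - u * u / 2)) by (field; lra).
replace (1 + u * v - u * u / 2) with (v * (u - v)) by lra.
field; lra.
Qed.

(** There is room to spare: [S >= a] gives [t > 2 a + 1], hence [s < 1 / 4]. Then the left side of
    the last inequality is at most [2 a^2 + a / 4], the right side at least [15 / 16] of
    [3 a^2 + 3 a + 2]. *)
Lemma rho2_crit (a B S rh s t : R) : 2 < a -> 1 + a <= B -> 0 <= S -> S ^ 2 = B ^ 2 - (a - 1) ->
  0 < rh <= a / 2 -> 0 < s -> t * s = rh -> B + S < t ->
  s < 1 / 4 /\ 2 * a * s < t * (1 - s ^ 2) /\
  4 * a * (t * s + s ^ 2) < (1 - s ^ 2) * (t ^ 2 - B ^ 2).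
Proof.
intros Ha HB HS HS2 Hrh Hs Hts Ht.
assert (HSa : a <= S) by nra.
assert (Ht1 : 2 * a + 1 < t) by lra.
assert (Hs4 : s < 1 / 4) by nra.
split; auto.
assert (Hss : s ^ 2 < 1 / 16) by nra.
split; [nra|].
assert (H1 : 3 * a ^ 2 + 3 * a + 2 <= t ^ 2 - B ^ 2).
{ assert ((B + S) ^ 2 <= t ^ 2) by (apply pow_incr; lra).
  assert ((1 + a) * a <= B * S) by (apply Rmult_le_compat; lra).
  assert ((1 + a) ^ 2 <= B ^ 2) by (apply pow_incr; lra).
  nra. }
assert (H2 : 15 / 16 * (3 * a ^ 2 + 3 * a + 2) <= (1 - s ^ 2) * (t ^ 2 - B ^ 2)) by (apply Rmult_le_compat; nra).
rewrite Hts; nra.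
Qed.

(** [B + S] is the larger root of [x^2 - 2 B x + 1], so [t > B + S] and [s = 1 / t] give
    [t + s > 2 B]. Replacing [B] by [w = (t + s) / 2] and [a] by [w - 1] only strengthens the second
    claim and leaves a rational function of [s] with the factor [(1 - s)^3]. *)
Lemma rho3_crit (a B S s t : R) : 0 < a -> 1 + a <= B -> 0 <= S -> S ^ 2 = B ^ 2 - 1 ->
  0 < s < 1 -> t * s = 1 -> B + S < t ->
  2 * a * s < t * (1 - s ^ 2) /\
  4 * a * (t * s + s ^ 2) < (1 - s ^ 2) * (t ^ 2 - B ^ 2).
Proof.
intros Ha HB HS HS2 Hs Hts Ht.
assert (Et : t = 1 / s) by (rewrite <- Hts; field; lra).
assert (Ht1 : 2 * B * t < t ^ 2 + 1) by nra.
assert (Ht2 : 2 * B < t + s).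
{ apply (Rmult_lt_reg_r t); [lra|]; replace ((t + s) * t) with (t ^ 2 + t * s) by ring; lra. }
assert (Hss : 0 < 1 - s ^ 2) by nra.
split.
- replace (t * (1 - s ^ 2)) with (t - s) by (rewrite Et; field; lra).
  assert (2 * a * s <= (t + s - 2) * s) by (apply Rmult_le_compat_r; lra).
  nra.
- set (w := (t + s) / 2).
  assert (H1 : (1 - s ^ 2) * (t ^ 2 - w ^ 2) <= (1 - s ^ 2) * (t ^ 2 - B ^ 2)).
  { apply Rmult_le_compat_l; [lra|]; assert (B ^ 2 <= w ^ 2) by (apply pow_incr; unfold w; lra); lra. }
  assert (H2 : 4 * a * (t * s + s ^ 2) < 4 * (w - 1) * (1 + s ^ 2)).
  { rewrite Hts; apply Rmult_lt_compat_r; [nra|]; unfold w; lra. }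
  assert (H3 : (1 - s ^ 2) * (t ^ 2 - w ^ 2) - 4 * (w - 1) * (1 + s ^ 2)
    = (1 - s) ^ 3 * (3 + s + 5 * s ^ 2 - s ^ 3) / (4 * s ^ 2)).
  { unfold w; rewrite Et; field; lra. }
  assert (H4 : 0 <= (1 - s) ^ 3 * (3 + s + 5 * s ^ 2 - s ^ 3) / (4 * s ^ 2)).
  { apply Rdiv_le_0_compat; [|nra]; apply Rmult_le_pos; [apply pow_le; lra|].
    assert (s ^ 3 <= 1) by (rewrite <- (pow1 3); apply pow_incr; lra). nra. }
  lra.
Qed.

(** * Extension of the resolvent and the covering radii *)

Theorem theorem3p1 (q : C) (hq : 0 < Re q) :
  (forall (r : R) (G : C -> C), 2 / Re q < r -> resolvents q r G ->
     1 < rho q r /\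
     exists Gext : C -> C,
       (forall w, Disk 1 w -> Gext w = G w) /\
       univalent_on (Disk (rho q r)) Gext /\
       maps_into (Disk (rho q r)) (Disk (rho1 q r)) Gext /\
       image_contains Gext (Disk (rho q r)) (Disk (rho2 q r))) /\
  (forall (r : R) (G : C -> C), 0 < r -> resolvents q r G ->
     image_contains G (Disk 1) (Disk (rho3 q r))).
Proof.
assert (Hsetup : forall (r : R) (G : C -> C), 0 < r -> resolvents q r G -> exists P : C -> C,
  holomorphic_on (Disk 1) P /\
  (forall z, Disk 1 z -> 1 + r * Re q * ((1 - Cmod z) / (1 + Cmod z)) <= Cmod (P z)) /\
  (forall z t, Disk 1 z -> z <> 0%C -> 2 * (r * Re q) * Cmod z < t * (1 - Cmod z ^ 2) ->
    4 * (r * Re q) * (t * Cmod z + Cmod z ^ 2) < (1 - Cmod z ^ 2) * (t ^ 2 - Cmod (1 + r * q)%C ^ 2) ->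
    Cmod (P z) < t) /\
  (forall w, Disk 1 w -> Disk 1 (G w) /\ (G w * P (G w))%C = w)).
{ intros r G Hr [f [[p [Hp [Hre [H0 Hf]]]] [_ [Hmap Heq]]]].
  assert (Hgrow := caratheodory_growth q p hq Hp Hre H0).
  exists (fun z => (r * p z + 1)%C); split; [|split; [|split]].
  - apply holomorphic_of_lin_approx; intros z Hz.
    destruct (holomorphic_lin_approx _ _ _ Hp Hz) as [D HD]; eexists.
    exact (lin_approx_comp (fun x => r * x + 1)%C p z _ _ (lin_approx_affine _ _ _) HD).
  - intros z Hz; assert (Hz' := Hz); unfold Disk in Hz'.
    generalize (Cmod_ge_0 z); intros Hz0.
    assert (HL := caratheodory_Re_lower q (p z) (Cmod z) hq (Hre z Hz) ltac:(lra) (Hgrow z Hz)).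
    eapply Rle_trans; [|apply Re_Cmod_bounds].
    replace (Re (r * p z + 1)%C) with (1 + r * Re (p z)) by (unfold Re, Im; simpl; ring).
    apply Rplus_le_compat_l; rewrite Rmult_assoc; apply Rmult_le_compat_l; [lra|].
    unfold Rdiv; rewrite <- Rmult_assoc; apply Rle_div_l; lra.
  - intros z t Hz Hz0 H1 H2.
    rewrite Cplus_comm; apply (growth_upper q (p z) r (Cmod z) t); auto.
    split; [exact (proj1 (Cmod_gt_0 z) Hz0)|exact Hz].
  - intros w Hw; split; [apply Hmap; auto|].
    assert (Hm := Hmap w Hw).
    rewrite <- (Heq w Hw) at 3; rewrite Hf by auto; ring. }
assert (HB : forall r, 0 < r -> 1 + r * Re q <= Cmod (1 + r * q)%C).
{ intros r Hr; eapply Rle_trans; [|apply Re_Cmod_bounds]; unfold Re; simpl; lra. }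
assert (Hz0 : forall z : C, z <> 0%C -> 0 < Cmod z) by (intros z; apply (Cmod_gt_0 z)).
(* Radii [(1, 1)], where [|P| >= 1] is enough. *)
assert (Hinv1 : forall (r : R) (P : C -> C), 0 < r -> holomorphic_on (Disk 1) P ->
  (forall z, Disk 1 z -> 1 + r * Re q * ((1 - Cmod z) / (1 + Cmod z)) <= Cmod (P z)) ->
  exists g : C -> C, holomorphic_on (Disk 1) g /\
    (forall w, Disk 1 w -> Disk 1 (g w) /\ (g w * P (g w))%C = w) /\
    (forall z, Disk 1 z -> Disk 1 (z * P z)%C -> g (z * P z)%C = z)).
{ intros r P Hr HP Hlow; apply inverse_mult_eq; auto; try lra.
  intros z Hz; specialize (Hlow z Hz); unfold Disk in Hz; generalize (Cmod_ge_0 z); intros.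
  assert (0 <= r * Re q * ((1 - Cmod z) / (1 + Cmod z))); [|lra].
  apply Rmult_le_pos; [nra|apply Rdiv_le_0_compat; lra]. }
split; intros r G Hr HG.
- apply Rlt_div_l in Hr; auto.
  set (a := r * Re q) in *.
  assert (Hr0 : 0 < r) by (unfold a in Hr; nra).
  destruct (Hsetup r G Hr0 HG) as [P [HP [Hlow [Hup HGeq]]]].
  assert (Erho : rho q r = (sqrt (2 * a) - sqrt (a - 1)) ^ 2).
  { unfold rho, a; rewrite Rmult_assoc; reflexivity. }
  assert (Erho1 : rho1 q r = sqrt (2 * a / (a - 1)) - 1).
  { unfold rho1, a; rewrite Rmult_assoc; reflexivity. }
  destruct (rho_rho1_spec a Hr) as [R1 [R2 [R3 R4]]].
  rewrite <- Erho, <- Erho1 in *.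
  set (rh := rho q r) in *; set (rh1 := rho1 q r) in *.
  split; auto.
  destruct (Hinv1 r P Hr0 HP Hlow) as [g1 [_ [_ Hg1]]].
  destruct (inverse_mult_eq rh1 rh P) as [g [Hg [Hg2 Hg3]]]; [lra|lra| | |].
  { intros z Hz; apply HP; unfold Disk in *; lra. }
  (* Since [(1 - x) / (1 + x)] decreases, the lower bound for [|P|] is smallest at the edge
     [|z| = rh1], where it equals [rh / rh1]. *)
  { intros z Hz; rewrite <- R4; apply Rmult_le_compat_l; [lra|].
    unfold Disk in *; eapply Rle_trans; [|apply Hlow; unfold Disk; lra].
    fold a; apply Rplus_le_compat_l, Rmult_le_compat_l; [lra|].
    generalize (Cmod_ge_0 z); intros.
    refine (proj1 (Rle_div_r _ _ _ _) _); [lra|].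
    replace ((1 - rh1) / (1 + rh1) * (1 + Cmod z)) with ((1 - rh1) * (1 + Cmod z) / (1 + rh1)) by (field; lra).
    apply Rle_div_l; [lra|]; nra. }
  exists g; split; [|split; [split; [exact Hg|]|split]].
  + intros w Hw.
    destruct (Hg2 w) as [A1 A2]; [unfold Disk in *; lra|].
    destruct (HGeq w Hw) as [B1 B2].
    (* Both [g w] and [G w] lie in the unit disk and solve the equation for [w], so both equal
       [g1 w]. *)
    rewrite <- (Hg1 (g w)), <- (Hg1 (G w)); rewrite ?A2, ?B2; auto.
    unfold Disk in *; lra.
  + intros z w Hz Hw E.
    destruct (Hg2 z Hz) as [_ A2]; destruct (Hg2 w Hw) as [_ B2].
    rewrite <- A2, <- B2, E; reflexivity.
  + intros w Hw; apply Hg2; auto.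
  + intros z Hz; exists (z * P z)%C.
    (* The origin is treated apart because the threshold is [t = rh / |z|]. *)
    destruct (Ceq_dec z 0%C) as [->|Ez].
    * assert (E : (0 * P 0)%C = 0%C) by ring.
      assert (D : Disk rh (0 * P 0)%C) by (unfold Disk; rewrite E, Cmod_0; lra).
      split; auto; apply Hg3; auto; unfold Disk; rewrite Cmod_0; lra.
    * specialize (Hz0 z Ez).
      specialize (HB r Hr0); fold a in HB.
      set (B := Cmod (1 + r * q)%C) in *.
      assert (ES : 2 + a + r ^ 2 * Cmod q ^ 2 = B ^ 2 - (a - 1)).
      { unfold B, a; rewrite !Cmod2_alt; unfold Re, Im; simpl; ring. }
      assert (HS0 : 0 <= B ^ 2 - (a - 1)) by nra.
      unfold Disk, rho2 in Hz; change ((sqrt (2 * r * Re q) - sqrt (r * Re q - 1)) ^ 2) with rh in Hz.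
      fold a B in Hz; rewrite ES in Hz.
      set (S := sqrt (B ^ 2 - (a - 1))) in *.
      assert (HS : 0 <= S) by apply sqrt_pos.
      assert (ES2 : S ^ 2 = B ^ 2 - (a - 1)) by (unfold S; apply pow2_sqrt; auto).
      assert (Ht : B + S < rh / Cmod z).
      { apply Rlt_div_r; auto; apply Rlt_div_r in Hz; lra. }
      assert (Hts : rh / Cmod z * Cmod z = rh) by (field; lra).
      destruct (rho2_crit a B S rh (Cmod z) (rh / Cmod z)) as [C1 [C2 C3]]; auto; [lra|].
      assert (HPz : Cmod (P z) < rh / Cmod z) by (apply Hup; auto; unfold Disk; lra).
      assert (D : Disk rh (z * P z)%C).
      { unfold Disk; rewrite Cmod_mult, <- Hts, Rmult_comm; apply Rmult_lt_compat_r; auto. }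
      split; auto; apply Hg3; auto; unfold Disk; lra.
- destruct (Hsetup r G Hr HG) as [P [HP [Hlow [Hup HGeq]]]].
  destruct (Hinv1 r P Hr HP Hlow) as [g1 [_ [_ Hg1]]].
  intros z Hz; exists (z * P z)%C.
  specialize (HB r Hr); unfold Disk, rho3 in Hz.
  assert (Ha : 0 < r * Re q) by nra.
  set (a := r * Re q) in *; set (B := Cmod (1 + r * q)%C) in *.
  set (S := sqrt (B ^ 2 - 1)) in *.
  assert (HS : 0 <= S) by apply sqrt_pos.
  assert (ES2 : S ^ 2 = B ^ 2 - 1) by (unfold S; apply pow2_sqrt; nra).
  assert (Hz1 : Disk 1 z).
  { unfold Disk; eapply Rlt_trans; [exact Hz|]; apply Rlt_div_l; lra. }
  assert (D : Disk 1 (z * P z)%C).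
  { destruct (Ceq_dec z 0%C) as [->|Ez].
    - unfold Disk; replace (0 * P 0)%C with (RtoC 0) by ring; rewrite Cmod_0; lra.
    - specialize (Hz0 z Ez).
      assert (Ht : B + S < 1 / Cmod z).
      { apply Rlt_div_r; auto; apply Rlt_div_r in Hz; lra. }
      assert (Hts : 1 / Cmod z * Cmod z = 1) by (field; lra).
      destruct (rho3_crit a B S (Cmod z) (1 / Cmod z)) as [C2 C3]; auto.
      assert (HPz : Cmod (P z) < 1 / Cmod z) by (apply Hup; auto).
      unfold Disk; rewrite Cmod_mult, <- Hts, Rmult_comm; apply Rmult_lt_compat_r; auto. }
  split; auto.
  (* [z] and [G (z * P z)] solve the same equation in the unit disk, so [g1] identifies them. *)
  destruct (HGeq _ D) as [B1 B2].
  rewrite <- (Hg1 (G (z * P z)%C)), B2; auto; rewrite B2; auto.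
Qed.
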